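(* Let $\alpha=1/2$, $\beta\in\frac{\mathbb{N}}{2}$, $\Omega=[0,\alpha)\cup[\alpha+\beta,1+\beta)=[0,1/2)\cup[1/2+\beta,1+\beta)\subset\mathbb{R}$ and $g=\chi_\Omega$. Let $\Lambda\subset\mathbb{R}^2$ be a discrete countable set. If the Gabor system $\{g_\lambda\}_{\lambda\in\Lambda}$ is a Gabor orthonormal basis for $L^2(\mathbb{R})$, then $\Lambda$ is standard, i.e. $$\Lambda=\bigcup_{k\in K}\left\{\frac k2\right\}\times\left(\frac{L_k+a_k}{2\beta+1}\right),$$ where (i) $K, L_k\subseteq\mathbb{Z}$ for every $k\in K$; (ii) $a_k\in[0,1)$ for every $k\in K$; (iii) $K\cup\big((2\beta+1)+K\big)=\mathbb{Z}$; (iv) $L_k+\{2n:\ n=0,\pm1,\ldots,\pm2\beta\}=\mathbb{Z}$.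
   Context: $\mathbb{N}$ denotes the positive integers and $\frac{\mathbb{N}}{2}=\{n/2:n\in\mathbb{N}\}$. For $\lambda=(t,\nu)\in\mathbb{R}^2$ ($t$ the time coordinate, $\nu$ the frequency coordinate), $g_\lambda(x)=g(x-t)e^{2\pi i x\nu}$; the Gabor system associated to the window $g$ and the set $\Lambda$ is $\{g_\lambda\}_{\lambda\in\Lambda}$. In general, $\Lambda$ is called ($\Omega$-)standard if $\Lambda=\bigcup_{t\in J}\{t\}\times\Lambda_t$, where $\bigcup_{t\in J}(\Omega+t)=\mathbb{R}$ and, for every $t\in J$, the system $\{e^{2\pi i\lambda x}\}_{\lambda\in\Lambda_t}$ is an orthonormal basis for $L^2(\Omega+t)$ (equivalently, for $L^2(\Omega)$). For sets $A,B\subseteq\mathbb{R}$ and numbers $a$, $c\neq0$: $A+B=\{x+y:x\in A,\ y\in B\}$, $a+A=A+a=\{x+a:x\in A\}$ and $\frac{A}{c}=\{x/c:x\in A\}$.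
   Formalization: As printed the form fails for Λ shifted in time by 1/4; the time coordinates are proved to be τ + k/2 for some τ in [0,1/2) instead of k/2, and τ = 0 whenever some point of Λ has time coordinate in Z/2 (e.g. if (0,0) ∈ Λ). *)

(* Defs.v *)
From HB Require Import structures.
From mathcomp Require Import all_boot all_order all_algebra.
From mathcomp Require Import complex.
From mathcomp Require Import all_classical all_reals all_analysis.

Set Implicit Arguments.
Unset Strict Implicit.
Unset Printing Implicit Defensive.

Import Order.TTheory GRing.Theory Num.Theory.
Import numFieldNormedType.Exports.

Local Open Scope classical_set_scope.
Local Open Scope ring_scope.

Definition sumset {R : realType} (A B : set R) : set R :=
  [set x + y | x in A & y in B].

Definition translate {R : realType} (a : R) (A : set R) : set R :=
  [set a + x | x in A].

Definition divset {R : realType} (A : set R) (c : R) : set R :=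
  [set x / c | x in A].

Definition intset {R : realType} : set R := range (fun n : int => n%:~R).

(* The Hilbert space L^2(D) of complex-valued functions. Its elements are
   represented by functions R -> R[i] instead of classes of functions modulo
   equality almost everywhere on D. *)

Definition csqnorm {R : realType} (z : R[i]) : R :=
  complex.Re z ^+ 2 + complex.Im z ^+ 2.

Definition sqnorm2 {R : realType} (D : set R) (f : R -> R[i]) : \bar R :=
  (\int[lebesgue_measure]_(x in D) (csqnorm (f x))%:E)%E.

Definition inL2 {R : realType} (D : set R) (f : R -> R[i]) : Prop :=
  [/\ measurable_fun D (fun x => complex.Re (f x)),
      measurable_fun D (fun x => complex.Im (f x)) &
      (sqnorm2 D f < +oo)%E].

Definition cintegral {R : realType} (D : set R) (f : R -> R[i]) : R[i] :=
  Complex (\int[lebesgue_measure]_(x in D) complex.Re (f x))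
          (\int[lebesgue_measure]_(x in D) complex.Im (f x)).

Definition inner {R : realType} (D : set R) (f h : R -> R[i]) : R[i] :=
  cintegral D (fun x => f x * conjc (h x)).

Definition orthonormal_family {R : realType} (D : set R) {T : choiceType}
    (I : set T) (e : T -> R -> R[i]) : Prop :=
  (forall i, I i -> inL2 D (e i)) /\
  (forall i j, I i -> I j -> inner D (e i) (e j) = (i == j)%:R).

Definition total_family {R : realType} (D : set R) {T : choiceType}
    (I : set T) (e : T -> R -> R[i]) : Prop :=
  forall f, inL2 D f -> forall eps : R, 0 < eps ->
    exists (s : seq T) (c : T -> R[i]),
      (forall i, i \in s -> I i) /\
      (sqnorm2 D (fun x => (f x - \sum_(i <- s) c i * e i x)%R) < eps%:E)%E.

Definition orthonormal_basis {R : realType} (D : set R) {T : choiceType}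
    (I : set T) (e : T -> R -> R[i]) : Prop :=
  orthonormal_family D I e /\ total_family D I e.

Definition expi {R : realType} (y : R) : R[i] := Complex (cos y) (sin y).

Definition exponential {R : realType} (nu x : R) : R[i] :=
  expi (2 * pi * nu * x).

Definition gabor {R : realType} (g : R -> R[i]) (la : R * R) (x : R) : R[i] :=
  g (x - la.1) * expi (2 * pi * x * la.2).

Definition gabor_orthonormal_basis {R : realType} (g : R -> R[i])
    (Lambda : set (R * R)) : Prop :=
  orthonormal_basis setT Lambda (gabor g).

Definition charfun {R : realType} (A : set R) (x : R) : R[i] :=
  Complex (\1_A x) 0.

Definition standard {R : realType} (Omega : set R) (Lambda : set (R * R)) :
    Prop :=
  exists (J : set R) (La : R -> set R),
    [/\ Lambda = \bigcup_(t in J) ([set t] `*` La t),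
        \bigcup_(t in J) translate t Omega = setT &
        forall t, J t ->
          orthonormal_basis (translate t Omega) (La t) exponential].

Definition discrete_set {R : realType} (Lambda : set (R * R)) : Prop :=
  isolated Lambda = Lambda.

Definition OmegaS {R : realType} (alpha beta : R) : set R :=
  `[0, alpha[ `|` `[alpha + beta, 1 + beta[.

(* The time coordinates are tau + K/2: being a Gabor basis is invariant under
   a translation of Lambda in time, so K/2 can only be determined up to a real
   number tau, normalized here to lie in [0, 1/2). If a point of Lambda has its
   time coordinate in Z/2, in particular if Lambda contains (0, 0), then
   tau = 0. *)
Definition standard_form {R : realType} (beta tau : R) (Lambda : set (R * R))
    (K : set R) (L : R -> set R) (a : R -> R) : Prop :=
  Lambda = \bigcup_(k in K)
    ([set tau + k / 2] `*` divset (translate (a k) (L k)) (2 * beta + 1)).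

(* Main.v *)
(* Idea. Let N = 2 beta + 1, so that Omega consists of the half cells [0, 1/2)
   and N/2 + [0, 1/2). Two elements of the Gabor family whose supports meet
   are orthogonal only if their frequencies differ by at least 2, or if their
   times differ by less than 1/2 and N times the frequency difference is odd.
   As a sum of two odd numbers is even, at most two elements cover a given
   point with frequencies in a given half-open window of length 2.

   Completeness forces exactly two. Let phi(z) be the squared modulus of the
   inner product of the half cell shifted by z with the window. Parseval gives
   sum_la phi(z - la) >= 1/2 for all z, and Tonelli exchanges this sum with
   the integral over the reflected box p - Omega x [0, 2), of area 2: the
   integral of phi(v) times the number of elements in the window at p - v is
   at least 1. The same exchange with the lattice (Z/2) x 2Z and Bessel's
   inequality shows that the integral of phi is at most 1/2. As a window
   contains at most two elements, one with fewer would contradict these bounds,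
   because window counts are semicontinuous from the right.

   The rest is combinatorial. The frequencies covering a point are 2-periodic
   with two elements per period; consecutive ones differ by less than 2, hence
   cover the point with the same half cell of Omega. If two half cells
   overlapped properly, the chain of overlapping half cells would propagate to
   the right, and reach a time where a point is covered by both halves. So the
   half cells tile the line, their starting points are tau + Z/2, and at each
   point all the elements covering it have the same time. *)

Require Import Defs.
From HB Require Import structures.
From mathcomp Require Import all_boot all_order all_algebra.
From mathcomp Require Import complex.
From mathcomp Require Import all_classical all_reals all_analysis.
From mathcomp Require Import measurable_realfun ring lra zify.

Set Implicit Arguments.
Unset Strict Implicit.
Unset Printing Implicit Defensive.

Import Order.TTheory GRing.Theory Num.Theory.
Import numFieldNormedType.Exports.

Local Open Scope classical_set_scope.
Local Open Scope ring_scope.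

(** * Bessel and Parseval in L2 *)

Section L2.
Context {R : realType} (D : set R).
Hypothesis mD : measurable (D : set (measurableTypeR R)).
Local Notation mu := (@lebesgue_measure R).
Local Notation Re := complex.Re.
Local Notation Im := complex.Im.
Implicit Types (f h : R -> R[i]) (c : R[i]).

(** [fine] sends an infinite integral to 0, so this is the squared norm only for functions in
    [inL2]. *)
Definition nrm2 f : R := fine (sqnorm2 D f).

Lemma csqnorm_ge0 c : 0 <= csqnorm c.
Proof. by rewrite addr_ge0 ?sqr_ge0. Qed.

Lemma cReD c d : Re (c + d) = Re c + Re d. Proof. by case: c; case: d. Qed.
Lemma cImD c d : Im (c + d) = Im c + Im d. Proof. by case: c; case: d. Qed.
Lemma cReB c d : Re (c - d) = Re c - Re d. Proof. by case: c; case: d. Qed.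
Lemma cImB c d : Im (c - d) = Im c - Im d. Proof. by case: c; case: d. Qed.
Lemma cReM c d : Re (c * d) = Re c * Re d - Im c * Im d.
Proof. by case: c; case: d. Qed.
Lemma cImM c d : Im (c * d) = Re c * Im d + Im c * Re d.
Proof. by case: c; case: d. Qed.
Lemma cReJ c : Re (conjc c) = Re c. Proof. by case: c. Qed.
Lemma cImJ c : Im (conjc c) = - Im c. Proof. by case: c. Qed.

Lemma complex_ext c d : Re c = Re d -> Im c = Im d -> c = d.
Proof. by case: c => a b; case: d => a' b' /= -> ->. Qed.

Lemma csqnormM c d : csqnorm (c * d) = csqnorm c * csqnorm d.
Proof. by rewrite /csqnorm cReM cImM; ring. Qed.

(** The product is dominated pointwise by u^2 + v^2, because (u + v)^2 and (u - v)^2 are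
    nonnegative. *)
Lemma sq_integrable_mul (u v : R -> R) :
  measurable_fun D u -> measurable_fun D v ->
  mu.-integrable D (EFin \o (fun x => u x ^+ 2)) ->
  mu.-integrable D (EFin \o (fun x => v x ^+ 2)) ->
  mu.-integrable D (EFin \o (fun x => u x * v x)).
Proof.
move=> um vm iu iv; have := integrableD mD iu iv.
apply: le_integrable => //.
  by apply/measurable_EFinP; exact: measurable_funM.
move=> x Dx /=; rewrite lee_fin.
have := sqr_ge0 (u x + v x); have := sqr_ge0 (u x - v x).
have := sqr_ge0 (u x); have := sqr_ge0 (v x); move=> h1 h2 h3 h4.
by rewrite [leRHS]ger0_norm ?addr_ge0// ler_norml; nra.
Qed.

Lemma inL2P f : inL2 D f <-> [/\ measurable_fun D (fun x => Re (f x)),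
  measurable_fun D (fun x => Im (f x)),
  mu.-integrable D (EFin \o (fun x => Re (f x) ^+ 2)) &
  mu.-integrable D (EFin \o (fun x => Im (f x) ^+ 2))].
Proof.
split=> [[mr mi fin]|[mr mi ir ii]]; split=> //.
- apply: (@le_integrable _ _ _ _ _ mD _ (fun x => (csqnorm (f x))%:E)).
  + by apply/measurable_EFinP; exact: measurable_funX.
  + move=> x _ /=; rewrite lee_fin !ger0_norm ?csqnorm_ge0 ?sqr_ge0//.
    by rewrite lerDl sqr_ge0.
  + apply/integrableP; split.
      by apply/measurable_EFinP; apply: measurable_funD; exact: measurable_funX.
    by under eq_integral do rewrite gee0_abs ?lee_fin ?csqnorm_ge0//.
- apply: (@le_integrable _ _ _ _ _ mD _ (fun x => (csqnorm (f x))%:E)).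
  + by apply/measurable_EFinP; exact: measurable_funX.
  + move=> x _ /=; rewrite lee_fin !ger0_norm ?csqnorm_ge0 ?sqr_ge0//.
    by rewrite lerDr sqr_ge0.
  + apply/integrableP; split.
      by apply/measurable_EFinP; apply: measurable_funD; exact: measurable_funX.
    by under eq_integral do rewrite gee0_abs ?lee_fin ?csqnorm_ge0//.
- have /integrableP[_] := integrableD mD ir ii.
  apply: le_lt_trans; rewrite le_eqVlt; apply/orP; left; apply/eqP.
  by apply: eq_integral => x _; rewrite /= ger0_norm// addr_ge0 ?sqr_ge0.
Qed.

Lemma csqnorm_integrable f : inL2 D f ->
  mu.-integrable D (EFin \o (fun x => csqnorm (f x))).
Proof. by move=> /inL2P[_ _ ir ii]; have := integrableD mD ir ii. Qed.

Lemma nrm2E f : nrm2 f = \int[mu]_(x in D) csqnorm (f x).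
Proof. by []. Qed.

Lemma sqnorm2E f : inL2 D f -> sqnorm2 D f = (nrm2 f)%:E.
Proof.
by move=> /csqnorm_integrable If; rewrite /nrm2 fineK//; exact: integrable_fin_num.
Qed.

Lemma nrm2_ge0 f : 0 <= nrm2 f.
Proof. by apply: Rintegral_ge0 => x _; exact: csqnorm_ge0. Qed.

Lemma inner_integrable f h : inL2 D f -> inL2 D h ->
  mu.-integrable D (EFin \o (fun x => Re (f x * conjc (h x)))) /\
  mu.-integrable D (EFin \o (fun x => Im (f x * conjc (h x)))).
Proof.
move=> /inL2P[fr fi fr2 fi2] /inL2P[hr hi hr2 hi2]; split.
- have := integrableD mD (sq_integrable_mul fr hr fr2 hr2)
                         (sq_integrable_mul fi hi fi2 hi2).
  by apply: eq_integrable => // x _ /=; rewrite cReM cReJ cImJ mulrN opprK.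
- have := integrableB mD (sq_integrable_mul fi hr fi2 hr2)
                         (sq_integrable_mul fr hi fr2 hi2).
  apply: eq_integrable => // x _ /=; rewrite cImM cReJ cImJ mulrN addrC.
  by [].
Qed.

Lemma inL2_sub f h c : inL2 D f -> inL2 D h -> inL2 D (fun x => f x - c * h x).
Proof.
move=> /inL2P[fr fi fr2 fi2] /inL2P[hr hi hr2 hi2].
have ReE x : Re (f x - c * h x) = Re (f x) - (Re c * Re (h x) - Im c * Im (h x)).
  by rewrite cReB cReM.
have ImE x : Im (f x - c * h x) = Im (f x) - (Re c * Im (h x) + Im c * Re (h x)).
  by rewrite cImB cImM.
split.
- under eq_fun do rewrite ReE.
  apply: measurable_funB => //.
  by apply: measurable_funB; apply: measurable_funM.
- under eq_fun do rewrite ImE.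
  apply: measurable_funB => //.
  by apply: measurable_funD; apply: measurable_funM.
- have I1 := integrableD mD fr2 fi2.
  have I2 := integrableD mD hr2 hi2.
  have /integrableP[_] := integrableD mD (integrableZl mD 2 I1)
    (integrableZl mD (2 * csqnorm c) I2).
  apply: le_lt_trans; apply: ge0_le_integral => //.
  + by move=> x _; rewrite lee_fin csqnorm_ge0.
  + apply/measurable_EFinP; apply: measurable_funD; apply: measurable_funX.
    * under eq_fun do rewrite ReE.
      apply: measurable_funB => //.
      by apply: measurable_funB; apply: measurable_funM.
    * under eq_fun do rewrite ImE.
      apply: measurable_funB => //.
      by apply: measurable_funD; apply: measurable_funM.
  + apply: measurableT_comp => //; apply: emeasurable_funD; apply: measurable_funeM;
    apply: emeasurable_funD; apply/measurable_EFinP; exact: measurable_funX.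
  move=> x _ /=; rewrite lee_fin ger0_norm; last first.
    by rewrite addr_ge0// mulr_ge0 ?addr_ge0 ?sqr_ge0// mulr_ge0// csqnorm_ge0.
  rewrite /csqnorm ReE ImE.
  move: (Re c) (Im c) (Re (f x)) (Im (f x)) (Re (h x)) (Im (h x)) => a b p q r s.
  (* The bound |f - ch|^2 <= 2|f|^2 + 2|c|^2|h|^2 comes from the parallelogram law, by dropping the
     term |f + ch|^2. *)
  have := sqr_ge0 (p + (a * r - b * s)); have := sqr_ge0 (q + (a * s + b * r)).
  by move=> h1 h2; nra.
Qed.

Lemma inner_sub f h k c : inL2 D f -> inL2 D h -> inL2 D k ->
  inner D (fun x => f x - c * h x) k = inner D f k - c * inner D h k.
Proof.
move=> Lf Lh Lk.
have [fr fi] := inner_integrable Lf Lk; have [hr hi] := inner_integrable Lh Lk.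
have iZ a (u : R -> R) : mu.-integrable D (EFin \o u) ->
    mu.-integrable D (EFin \o (fun x => a * u x)).
  by move=> iu; apply: eq_integrable (integrableZl mD a iu).
apply: complex_ext.
- rewrite cReB cReM /=.
  rewrite -!RintegralZl// -RintegralB//; [|exact: iZ..].
  rewrite -RintegralB//; last first.
    exact: eq_integrable (integrableB mD (iZ (Re c) _ hr) (iZ (Im c) _ hi)).
  by apply: eq_Rintegral => x _; rewrite !cReM cImM cReB cImB cReM cImM; ring.
- rewrite cImB cImM /=.
  rewrite -!RintegralZl// -RintegralD//; [|exact: iZ..].
  rewrite -RintegralB//; last first.
    exact: eq_integrable (integrableD mD (iZ (Re c) _ hi) (iZ (Im c) _ hr)).
  by apply: eq_Rintegral => x _; rewrite !cImM cReM cReB cImB cReM cImM; ring.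
Qed.

Lemma nrm2_sub f h c : inL2 D f -> inL2 D h ->
  nrm2 (fun x => f x - c * h x) = nrm2 f
    - 2 * (Re c * Re (inner D f h) + Im c * Im (inner D f h))
    + csqnorm c * nrm2 h.
Proof.
move=> Lf Lh; have [ir ii] := inner_integrable Lf Lh.
have If := csqnorm_integrable Lf; have Ih := csqnorm_integrable Lh.
have iZ a (u : R -> R) : mu.-integrable D (EFin \o u) ->
    mu.-integrable D (EFin \o (fun x => a * u x)).
  by move=> iu; apply: eq_integrable (integrableZl mD a iu).
rewrite !nrm2E /= -!RintegralZl// -RintegralD//; [|exact: iZ..].
have iC : mu.-integrable D (EFin \o (fun x => Re c * Re (f x * conjc (h x))
    + Im c * Im (f x * conjc (h x)))).
  exact: eq_integrable (integrableD mD (iZ (Re c) _ ir) (iZ (Im c) _ ii)).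
rewrite -RintegralZl// -RintegralB//; last exact: iZ.
rewrite -RintegralD//; [|exact: eq_integrable (integrableB mD If (iZ 2 _ iC))
  |exact: iZ].
apply: eq_Rintegral => x _.
by rewrite /csqnorm !(cReB, cImB, cReM, cImM, cReJ, cImJ); ring.
Qed.

Lemma inner_self f : inner D f f = Complex (nrm2 f) 0.
Proof.
rewrite /inner /cintegral nrm2E; congr Complex.
  by apply: eq_Rintegral => x _; rewrite cReM cReJ cImJ /csqnorm; ring.
rewrite -[RHS](mul0r (fine (mu D))) -Rintegral_cst//.
by apply: eq_Rintegral => x _; rewrite cImM cReJ cImJ; ring.
Qed.

Section Family.
Context {T : choiceType} (I : set T) (e : T -> R -> R[i]).
Hypothesis oe : orthonormal_family D I e.

Lemma inL2_comb (s : seq T) (c : T -> R[i]) f : (forall i, i \in s -> I i) ->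
  inL2 D f -> inL2 D (fun x => f x - \sum_(i <- s) c i * e i x).
Proof.
elim: s => [|j s IH] sI Lf.
  by move: Lf; congr inL2; apply/funext => x; rewrite big_nil subr0.
have Is i : i \in s -> I i by move=> h; apply: sI; rewrite inE h orbT.
have Ij : I j by apply: sI; rewrite mem_head.
have := inL2_sub (c j) (IH Is Lf) (oe.1 j Ij); congr inL2.
by apply/funext => x; rewrite big_cons opprD addrA addrAC.
Qed.

Lemma nrm2_e i : I i -> nrm2 (e i) = 1.
Proof. by move=> Ii; have := oe.2 i i Ii Ii; rewrite inner_self eqxx => -[]. Qed.

Lemma nrm2_pythagoras f j : inL2 D f -> I j ->
  nrm2 (fun x => f x - inner D f (e j) * e j x) = nrm2 f - csqnorm (inner D f (e j)).
Proof.
by move=> Lf Ij; rewrite nrm2_sub ?nrm2_e//; [rewrite /csqnorm; ring|exact: oe.1].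
Qed.

(** Subtracting from f its projection on [e j] lowers the squared norm by the coefficient at j and
    leaves the other coefficients unchanged, so induction on the list applies. *)
Lemma bessel f (S : seq T) : inL2 D f -> uniq S -> (forall i, i \in S -> I i) ->
  \sum_(i <- S) csqnorm (inner D f (e i)) <= nrm2 f.
Proof.
elim: S f => [|j S IH] f Lf; first by rewrite big_nil nrm2_ge0.
move=> /= /andP[jS uS] SI.
have IS i : i \in S -> I i by move=> h; apply: SI; rewrite inE h orbT.
have Ij : I j by apply: SI; rewrite mem_head.
have Lej := oe.1 j Ij.
have := IH _ (inL2_sub (inner D f (e j)) Lf Lej) uS IS.
rewrite nrm2_pythagoras// lerBrDl big_cons; apply: le_trans; rewrite lerD2l.
rewrite le_eqVlt; apply/orP; left; apply/eqP; apply: eq_big_seq => i iS.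
rewrite inner_sub//; last by apply: oe.1; exact: IS.
rewrite (oe.2 j i Ij (IS i iS)); case: eqVneq jS => [->|_ _].
  by rewrite iS.
by rewrite mulr0 subr0.
Qed.

(** For a duplicate-free [S] in [I] and f in [inL2], this is the squared distance from f to the span
    of the [e i] with i in [S]. It is therefore invariant under subtracting elements of that
    span. *)
Let defect (S : seq T) f := nrm2 f - \sum_(i <- S) csqnorm (inner D f (e i)).

Let defect_sub S f j c : inL2 D f -> uniq S -> (forall i, i \in S -> I i) ->
  j \in S -> defect S (fun x => f x - c * e j x) = defect S f.
Proof.
move=> Lf uS SI jS; have Ij := SI _ jS; have Lej := oe.1 j Ij.
rewrite /defect (nrm2_sub c Lf Lej) nrm2_e//.
have bigE (F : T -> R) : \sum_(i <- S) F i = F j + \sum_(i <- rem j S) F i.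
  by rewrite (big_rem j jS).
rewrite !bigE (eq_big_seq (fun i => csqnorm (inner D f (e i)))).
  rewrite inner_sub// (oe.2 j j Ij Ij) eqxx !mulr1.
  move: (\sum_(i <- rem j S) csqnorm _) => s.
  by rewrite /csqnorm cReB cImB; ring.
move=> i; rewrite mem_rem_uniq// inE => /andP[ij iS].
rewrite inner_sub//; last by apply: oe.1; exact: SI.
by rewrite (oe.2 j i Ij (SI i iS)) eq_sym (negbTE ij) mulr0 subr0.
Qed.

Let defect_comb S (s : seq T) (c : T -> R[i]) f : inL2 D f -> uniq S ->
  (forall i, i \in S -> I i) -> {subset s <= S} ->
  defect S (fun x => f x - \sum_(i <- s) c i * e i x) = defect S f.
Proof.
move=> Lf uS SI; elim: s => [|j s IH] sS.
  by congr defect; apply/funext => x; rewrite big_nil subr0.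
have ss : {subset s <= S} by move=> i h; apply: sS; rewrite inE h orbT.
rewrite -IH// -[RHS](@defect_sub S _ j (c j))//; last by apply: sS; rewrite mem_head.
  by congr defect; apply/funext => x; rewrite big_cons opprD addrA addrAC.
by apply: inL2_comb => // i /ss; exact: SI.
Qed.

(** Totality provides a combination within eps of f. The remainder has the same defect as f, and a
    defect is at most the squared norm. *)
Lemma parseval_le f (eps : R) : total_family D I e -> inL2 D f -> 0 < eps ->
  exists S : seq T, [/\ uniq S, (forall i, i \in S -> I i) &
    nrm2 f < \sum_(i <- S) csqnorm (inner D f (e i)) + eps].
Proof.
move=> tot Lf eps0; have [s [c [sI h]]] := tot f Lf eps eps0.
have SI i : i \in undup s -> I i by rewrite mem_undup; exact: sI.
exists (undup s); split => //; first exact: undup_uniq.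
move: h; rewrite sqnorm2E; last exact: inL2_comb.
rewrite lte_fin => h; rewrite -ltrBlDl; apply: le_lt_trans h.
have := @defect_comb (undup s) s c f Lf (undup_uniq s) SI.
rewrite /defect => <-; last by move=> i; rewrite mem_undup.
by rewrite lerBlDr lerDl sumr_ge0// => i _; exact: csqnorm_ge0.
Qed.

End Family.
End L2.

(** * Integrals of exponentials over intervals *)

Section Exponentials.
Context {R : realType}.
Local Notation mu := (@lebesgue_measure R).
Local Notation Re := complex.Re.
Local Notation Im := complex.Im.

Lemma continuous_itv_integrable (f : R -> R) (a b : R) : continuous f ->
  mu.-integrable `[a, b[ (EFin \o f).
Proof.
move=> cf; apply: (@integrableS _ (measurableTypeR R) _ mu `[a, b]%classic) => //.
  by apply: subset_itvl; rewrite bnd_simp.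
apply: continuous_compact_integrable; first exact: segment_compact.
exact: continuous_subspaceT.
Qed.

Lemma Rintegral_FTC2 (f F : R -> R) (a b : R) : a <= b -> continuous f ->
  (forall x : R, is_derive x 1 F (f x)) ->
  \int[mu]_(x in `[a, b[) f x = F b - F a.
Proof.
move=> ab cf dF.
rewrite Rintegral_itv_bndo_bndc; last exact: continuous_itv_integrable.
move: ab; rewrite le_eqVlt => /predU1P[->|ab].
  by rewrite set_itv1 Rintegral_set1 subrr.
have cF : continuous F.
  by move=> x; apply: differentiable_continuous; apply/derivable1_diffP.
rewrite /Rintegral (continuous_FTC2 ab (F := F))//.
- exact: continuous_subspaceT.
- by split => //; [exact/cvg_at_right_filter/cF|exact/cvg_at_left_filter/cF].
- by move=> x _; rewrite derive1E; apply: derive_val.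
Qed.

Lemma continuous_cos_lin (w : R) : continuous (fun x => cos (w * x)).
Proof.
move=> x; apply: continuous_comp; last exact: continuous_cos.
by apply: cvgM; [exact: cvg_cst|exact: cvg_id].
Qed.

Lemma continuous_sin_lin (w : R) : continuous (fun x => sin (w * x)).
Proof.
move=> x; apply: continuous_comp; last exact: continuous_sin.
by apply: cvgM; [exact: cvg_cst|exact: cvg_id].
Qed.

Lemma int_exponential (a b xi : R) : a <= b -> xi != 0 ->
  cintegral `[a, b[ (exponential xi) =
  Complex ((sin (2 * pi * xi * b) - sin (2 * pi * xi * a)) / (2 * pi * xi))
          ((cos (2 * pi * xi * a) - cos (2 * pi * xi * b)) / (2 * pi * xi)).
Proof.
move=> ab xi0; rewrite /cintegral /exponential/=.
set w := 2 * pi * xi.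
have w0 : w != 0 by rewrite !mulf_neq0 // gt_eqF // pi_gt0.
have dsin (x : R) : is_derive x 1 (fun y => w^-1 * sin (w * y)) (cos (w * x)).
  by apply: is_derive_eq; rewrite /GRing.scale/=; field.
have dcos (x : R) : is_derive x 1 (fun y => - w^-1 * cos (w * y)) (sin (w * x)).
  by apply: is_derive_eq; rewrite /GRing.scale/=; field.
rewrite (Rintegral_FTC2 ab (@continuous_cos_lin w) dsin).
rewrite (Rintegral_FTC2 ab (@continuous_sin_lin w) dcos).
by congr Complex; field.
Qed.

Lemma int_exponential0 (a b : R) : a <= b ->
  cintegral `[a, b[ (exponential 0) = Complex (b - a) 0.
Proof.
move=> ab; rewrite /cintegral /exponential/=; congr Complex.
- under eq_Rintegral do rewrite mulr0 mul0r cos0.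
  rewrite Rintegral_cst// mul1r.
  apply: (@congr1 _ _ fine (mu `[a, b[%classic) (b - a)%:E).
  rewrite lebesgue_measure_itv/= lte_fin.
  by case: ltgtP ab => // -> _; rewrite subrr.
- under eq_Rintegral do rewrite mulr0 mul0r sin0.
  by rewrite Rintegral_cst// mul0r.
Qed.

Lemma expiD (x y : R) : expi (x + y) = expi x * expi y.
Proof. by apply: complex_ext; rewrite ?cReM ?cImM /= ?cosD ?sinD//; ring. Qed.

Lemma conjc_expi (x : R) : conjc (expi x) = expi (- x).
Proof. by rewrite /expi /= cosN sinN. Qed.

Lemma csqnorm_expi (x : R) : csqnorm (expi x) = 1.
Proof. by rewrite /csqnorm /= cos2Dsin2. Qed.

Lemma expi0 : expi (0 : R) = 1.
Proof. by rewrite /expi cos0 sin0. Qed.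

(* The squared modulus of the integral of [exponential xi] over an interval of
   length [l]. *)
Definition kappa (l xi : R) : R :=
  if xi == 0 then l ^+ 2 else (sin (pi * xi * l) / (pi * xi)) ^+ 2.

Lemma csqnorm_int_exponential (a b xi : R) : a <= b ->
  csqnorm (cintegral `[a, b[ (exponential xi)) = kappa (b - a) xi.
Proof.
move=> ab; rewrite /kappa; case: eqVneq => [->|xi0].
  by rewrite int_exponential0// /csqnorm /= expr0n addr0.
rewrite int_exponential// /csqnorm /=.
set A := pi * xi * a; set B := pi * xi * b.
have -> : 2 * pi * xi * a = A + A by rewrite /A; ring.
have -> : 2 * pi * xi * b = B + B by rewrite /B; ring.
have -> : pi * xi * (b - a) = B - A by rewrite /A /B; ring.
have p0 : pi * xi != 0 by rewrite mulf_neq0 // gt_eqF // pi_gt0.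
rewrite sinB !sinD !cosD.
have hA := cos2Dsin2 A; have hB := cos2Dsin2 B.
have -> : 2 * pi * xi = 2 * (pi * xi) by ring.
move: (pi * xi) p0 (cos A) (sin A) (cos B) (sin B) hA hB => w w0 ca sa cb sb hA hB.
have sA : sa ^+ 2 = 1 - ca ^+ 2 by rewrite -hA; ring.
have sB : sb ^+ 2 = 1 - cb ^+ 2 by rewrite -hB; ring.
apply/eqP; rewrite -subr_eq0.
have -> : (((sb * cb + cb * sb - (sa * ca + ca * sa)) / (2 * w)) ^+ 2 +
  ((ca * ca - sa * sa - (cb * cb - sb * sb)) / (2 * w)) ^+ 2 -
  ((sb * ca - cb * sa) / w) ^+ 2) =
  ((4 * (sb * cb - sa * ca) ^+ 2 + (ca ^+ 2 - sa ^+ 2 - (cb ^+ 2 - sb ^+ 2)) ^+ 2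
   - 4 * (sb * ca - cb * sa) ^+ 2) / (4 * w ^+ 2)) by field.
suff -> : 4 * (sb * cb - sa * ca) ^+ 2 + (ca ^+ 2 - sa ^+ 2 - (cb ^+ 2 - sb ^+ 2)) ^+ 2
   - 4 * (sb * ca - cb * sa) ^+ 2 = 0 by rewrite mul0r.
(* The mixed products sa * ca * sb * cb cancel, so only even powers remain and the sines can be
   eliminated by cos^2 + sin^2 = 1. *)
have -> : 4 * (sb * cb - sa * ca) ^+ 2 + (ca ^+ 2 - sa ^+ 2 - (cb ^+ 2 - sb ^+ 2)) ^+ 2
   - 4 * (sb * ca - cb * sa) ^+ 2 =
  4 * (sb ^+ 2 * cb ^+ 2 + sa ^+ 2 * ca ^+ 2) - 4 * (sb ^+ 2 * ca ^+ 2 + cb ^+ 2 * sa ^+ 2)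
  + (ca ^+ 2 - sa ^+ 2 - (cb ^+ 2 - sb ^+ 2)) ^+ 2 by ring.
by rewrite sA sB; ring.
Qed.

Lemma int_exponential_shift (a b c xi : R) : a <= b ->
  cintegral `[a + c, b + c[ (exponential xi) =
  expi (2 * pi * xi * c) * cintegral `[a, b[ (exponential xi).
Proof.
move=> ab; have ab' : a + c <= b + c by rewrite lerD2r.
have [->|xi0] := eqVneq xi 0.
  rewrite !int_exponential0// !(mulr0, mul0r) expi0 mul1r.
  by congr Complex; ring.
rewrite !int_exponential//.
have w0 : 2 * pi * xi != 0 by rewrite !mulf_neq0 // gt_eqF // pi_gt0.
apply: complex_ext; rewrite ?cReM ?cImM /= !(mulrDr (2 * pi * xi)) !(sinD, cosD);
  by move: (2 * pi * xi) w0 => w w0; field.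
Qed.

Lemma cos_pi_nat (n : nat) : cos (pi * n%:R : R) = (-1) ^+ n.
Proof.
elim: n => [|n IH]; first by rewrite mulr0 cos0.
by rewrite -[n.+1%:R]natr1 mulrDr mulr1 cosDpi IH exprS mulN1r.
Qed.

Lemma sin_pi_int (k : int) : sin (pi * (k%:~R : R)) = 0.
Proof.
have sn (n : nat) : sin (pi * (n%:R : R)) = 0.
  elim: n => [|n IH]; first by rewrite mulr0 sin0.
  by rewrite -[n.+1%:R]natr1 mulrDr mulr1 sinDpi IH oppr0.
by case: k => n; rewrite ?NegzE ?rmorphN /= ?mulrN ?sinN sn ?oppr0.
Qed.

(** The sine is positive on ]0, pi[, so the fractional part of x has to vanish. *)
Lemma sin_pi_eq0 (x : R) : sin (pi * x) = 0 -> exists k : int, x = k%:~R.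
Proof.
move=> s0; exists (Num.floor x).
have := floor_itv x; rewrite intrD; set k := Num.floor x => kx.
have : sin (pi * (x - k%:~R)) = 0 by rewrite mulrBr sinB s0 sin_pi_int mul0r mulr0 subrr.
have [h|h] := eqVneq x k%:~R => //.
have x0 : 0 < x - k%:~R by rewrite subr_gt0 lt_neqAle eq_sym h; case/andP: kx.
have : 0 < sin (pi * (x - k%:~R)).
  apply: sin_gt0_pi; rewrite mulr_gt0 ?pi_gt0//=.
  rewrite -[ltRHS]mulr1 ltr_pM2l ?pi_gt0//; lra.
by move=> /lt0r_neq0 /eqP.
Qed.

Lemma kappa_eq0 (l xi : R) : kappa l xi = 0 -> 0 < l ->
  xi != 0 /\ exists k : int, xi * l = k%:~R.
Proof.
rewrite /kappa => + l0; case: eqVneq => [_ /eqP|xi0].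
  by rewrite sqrf_eq0 gt_eqF.
move=> /eqP; rewrite sqrf_eq0 mulf_eq0 invr_eq0 mulf_eq0 (gt_eqF (pi_gt0 R)).
by rewrite (negbTE xi0)/= orbF -mulrA => /eqP/sin_pi_eq0.
Qed.

(** The squared modulus is 2 + 2 cos(pi x), which forces cos(pi x) = -1 and sin(pi x) = 0. Thus x is
    an integer, and its parity is read off from cos(pi n) = (-1)^n. *)
Lemma one_add_expi_eq0 (x : R) : csqnorm (1 + expi (pi * x)) = 0 ->
  exists k : int, x = 2 * k%:~R + 1.
Proof.
rewrite /csqnorm cReD cImD /= add0r => h.
have /eqP := cos2Dsin2 (pi * x) => /eqP cs.
have c1 : cos (pi * x) = -1 by nra.
have s0 : sin (pi * x) = 0.
  by apply/eqP; rewrite -sqrf_eq0; apply/eqP; rewrite c1 in cs; lra.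
have [k hk] := sin_pi_eq0 s0.
have par (n : nat) : cos (pi * (n%:R : R)) = -1 -> odd n.
  rewrite cos_pi_nat; case: (odd n) (signr_odd R n) => //= <-.
  by move/eqP; rewrite expr0 -subr_eq0 opprK => /eqP; lra.
have oddk : odd `|k|%N.
  apply: par; rewrite -c1 hk; case: (k) => n //=.
  by rewrite NegzE rmorphN/= mulrN cosN.
have [m hm] : exists m : int, k = 2 * m + 1.
  by exists ((k - 1) %/ 2)%Z; lia.
by exists m; rewrite hk hm rmorphD rmorphM.
Qed.

End Exponentials.

(** * Combinatorics of packed time-frequency windows *)

(* lra rejects disequalities between pairs of reals. *)
Ltac plra :=
  lazymatch goal with
  | |- (?a : _ * _) <> _ => fail
  | |- _ => idtac
  end;
  repeat match goal with H : ?a <> ?b |- _ =>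
    match type of a with (_ * _)%type => clear H end end; lra.

Definition cell_start {R : realType} (N : nat) (b : bool) (la : R * R) : R :=
  la.1 + (if b then N%:R / 2 else 0).

Definition in_cell {R : realType} (N : nat) (b : bool) (x : R) (la : R * R) :=
  cell_start N b la <= x < cell_start N b la + 1 / 2.

Definition covers {R : realType} (N : nat) (x : R) (la : R * R) : Prop :=
  in_cell N false x la \/ in_cell N true x la.

Section Packing.
Context {R : realType} {N : nat} (P : set (R * R)).
Hypothesis N2 : (2 <= N)%N.
(** The hypotheses on [P] in this section are established for a Gabor basis by [basis_orth_near],
    [basis_orth_far], [basis_orth_two] and [basis_two_per_window]. *)
Hypothesis orth_near : forall la la', P la -> P la' -> la <> la' ->
  `|la.1 - la'.1| < 1 / 2 -> `|la.2 - la'.2| < 2 ->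
  exists k : int, N%:R * (la.2 - la'.2) = 2 * k%:~R + 1.
Hypothesis orth_far : forall la la', P la -> P la' ->
  `|la.1 - la'.1 - N%:R / 2| < 1 / 2 -> 2 <= `|la.2 - la'.2|.

(** If x lay in the second half cell of one element and the first half cell of the other, their
    times would differ by N/2 up to less than 1/2, and [orth_far] would separate the frequencies by
    at least 2. *)
Lemma in_cell_same x b b' la la' : P la -> P la' ->
  in_cell N b x la -> in_cell N b' x la' -> `|la.2 - la'.2| < 2 -> b = b'.
Proof.
move=> Pl Pl'; rewrite /in_cell /cell_start.
have far l l' : P l -> P l' -> `|l.1 - l'.1 - N%:R / 2| < 1 / 2 ->
    `|l.2 - l'.2| < 2 -> False.
  by move=> Pu Pu' /(orth_far Pu Pu') u1 u2; move: u1; rewrite leNgt u2.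
case: b; case: b' => // H1 H2 H3; exfalso.
- apply: (far la' la) => //; last by rewrite distrC.
  by rewrite ltr_norml; plra.
- apply: (far la la') => //.
  by rewrite ltr_norml; plra.
Qed.

Lemma covers_near x la la' : P la -> P la' -> la <> la' ->
  covers N x la -> covers N x la' -> `|la.2 - la'.2| < 2 ->
  exists k : int, N%:R * (la.2 - la'.2) = 2 * k%:~R + 1.
Proof.
move=> Pl Pl' ll' c c' d.
apply: orth_near => //.
have {c} [b cb] : exists b, in_cell N b x la by case: c; eexists; eassumption.
have {c'} [b' cb'] : exists b, in_cell N b x la' by case: c'; eexists; eassumption.
have bb := in_cell_same Pl Pl' cb cb' d; subst b'.
by move: cb cb'; rewrite /in_cell /cell_start ltr_norml; plra.
Qed.

Lemma no_three x l1 l2 l3 : P l1 -> P l2 -> P l3 ->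
  l1 <> l2 -> l2 <> l3 -> l1 <> l3 ->
  covers N x l1 -> covers N x l2 -> covers N x l3 ->
  `|l1.2 - l2.2| < 2 -> `|l2.2 - l3.2| < 2 -> `|l1.2 - l3.2| < 2 -> False.
Proof.
move=> P1 P2 P3 d12 d23 d13 c1 c2 c3 e12 e23 e13.
have [i Hi] := covers_near P1 P2 d12 c1 c2 e12.
have [j Hj] := covers_near P2 P3 d23 c2 c3 e23.
have [k Hk] := covers_near P1 P3 d13 c1 c3 e13.
(* The three differences times N are odd, yet one of them is the sum of the other two. *)
have : ((2 * (i + j + 1 - k))%:~R : R) = 1%:~R.
  by rewrite rmorphM rmorphB !rmorphD/=; plra.
by move/intr_inj; lia.
Qed.

Hypothesis orth_two : forall la la', P la -> P la' ->
  `|la.1 - la'.1| < 1 / 2 -> la.2 - la'.2 = 2 -> la.1 = la'.1.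
Hypothesis two_per_window : forall x w, exists la la',
  [/\ P la, P la', la <> la', covers N x la /\ covers N x la'
    & 0 <= w - la.2 < 2 /\ 0 <= w - la'.2 < 2].

Lemma covers_freq_eq x la la' : P la -> P la' ->
  covers N x la -> covers N x la' -> la.2 = la'.2 -> la = la'.
Proof.
move=> Pl Pl' c c' e; apply: contrapT => ne.
have [|k] := covers_near Pl Pl' ne c c'.
  by rewrite e subrr normr0.
rewrite e subrr mulr0 => h.
have : ((2 * k + 1)%:~R : R) = 0%:~R by rewrite rmorphD rmorphM/= -h.
by move/intr_inj; lia.
Qed.

(** The window of frequencies ]la.2, la.2 + 2] at x holds two elements l1 and l2, with l1 the lower
    one. If l2 stayed strictly below la.2 + 2, then la, l1 and l2 would contradict [no_three]. So l2
    sits exactly at la.2 + 2, and [orth_two] gives it the time of la. *)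
Lemma next_freq b x la : P la -> in_cell N b x la ->
  P (la.1, la.2 + 2) /\
  exists la', [/\ P la', in_cell N b x la' & la.2 < la'.2 < la.2 + 2].
Proof.
move=> Pl cb; have c : covers N x la by case: b cb => ?; [right|left].
have typ la' : P la' -> covers N x la' -> `|la.2 - la'.2| < 2 -> in_cell N b x la'.
  move=> Pl' [] c' d; first by rewrite (in_cell_same Pl Pl' cb c' d).
  by rewrite (in_cell_same Pl Pl' cb c' d).
have main l1 l2 : P l1 -> P l2 -> l1 <> l2 -> covers N x l1 -> covers N x l2 ->
    0 <= la.2 + 2 - l1.2 < 2 -> 0 <= la.2 + 2 - l2.2 < 2 -> l1.2 < l2.2 ->
  P (la.1, la.2 + 2) /\
  exists la', [/\ P la', in_cell N b x la' & la.2 < la'.2 < la.2 + 2].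
  move=> P1 P2 d12 c1 c2 w1 w2 l12.
  have t1 : in_cell N b x l1 by apply: typ => //; rewrite ltr_norml; plra.
  split; last by exists l1; split => //; plra.
  have e2 : l2.2 = la.2 + 2.
    apply: contrapT => /eqP; rewrite neq_lt => /orP[|] h; last by plra.
    apply: (@no_three x la l1 l2) => //; rewrite ?ltr_norml; try plra.
    - by move=> e; move: w1; rewrite e; plra.
    - by move=> e; move: w2; rewrite e; plra.
  (* The gap between la and l2 is exactly 2, too large for [in_cell_same]; the comparison passes
     through the intermediate l1. *)
  have t2 : in_cell N b x l2.
    case: c2 => c2.
      by rewrite (@in_cell_same x b false l1 l2) => //; rewrite ltr_norml; plra.
    by rewrite (@in_cell_same x b true l1 l2) => //; rewrite ltr_norml; plra.
  suff e1 : l2.1 = la.1 by rewrite -e1 -e2 -surjective_pairing.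
  apply: orth_two => //; last by rewrite e2; plra.
  by move: cb t2; rewrite /in_cell /cell_start ltr_norml; plra.
have [l1 [l2 [P1 P2 d12 [c1 c2] [w1 w2]]]] := two_per_window x (la.2 + 2).
have [h|h|h] := ltgtP l1.2 l2.2.
- exact: (main l1 l2).
- by apply: (main l2 l1) => //; apply/nesym.
- by have := covers_freq_eq P1 P2 c1 c2 h.
Qed.

Lemma shift_freq la (n : nat) : P la -> P (la.1, la.2 + 2 * n%:R).
Proof.
move=> Pl; elim: n => [|n IH].
  by rewrite mulr0 addr0 -surjective_pairing.
have c : in_cell N false la.1 (la.1, la.2 + 2 * n%:R).
  by rewrite /in_cell /cell_start/=; plra.
have [+ _] := next_freq IH c.
by rewrite /= -addrA -[n.+1%:R]natr1 mulrDr mulr1.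
Qed.

(** By 2-periodicity any element can be raised to within 2 of a higher frequency, which makes the
    results on close frequencies available for arbitrary pairs. *)
Lemma shift_freq_near (la la' : R * R) : la'.2 <= la.2 -> P la' ->
  exists n : nat, P (la'.1, la'.2 + 2 * n%:R) /\
    la.2 - 2 < la'.2 + 2 * n%:R <= la.2.
Proof.
move=> h Pl'; have h0 : 0 <= (la.2 - la'.2) / 2 by plra.
exists (Num.trunc ((la.2 - la'.2) / 2)); split; first exact: shift_freq.
have := truncn_itv h0; rewrite -[(Num.trunc _).+1%:R]natr1; plra.
Qed.

Lemma in_cell_type x b b' la la' : P la -> P la' ->
  in_cell N b x la -> in_cell N b' x la' -> b = b'.
Proof.
wlog h : b b' la la' / la'.2 <= la.2 => [wl Pl Pl' c c'|Pl Pl' c c'].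
  have [h|h] := leP la'.2 la.2; first exact: wl h Pl Pl' c c'.
  by apply/esym; apply: wl (ltW h) Pl' Pl c' c.
have [n [Pn hn]] := shift_freq_near h Pl'.
by apply: (@in_cell_same x b b' _ _ Pl Pn c c'); rewrite ltr_norml/=; plra.
Qed.

(** The endpoint l1.1 + 1/2 is covered by the first half of l2, hence by the first half of another
    element l3 at the next frequency. If l3 started earlier than this endpoint, the first halves of
    l1, l2 and l3 would share a point, and suitable frequency shifts would contradict [no_three]. *)
Lemma overlap_step l1 l2 : P l1 -> P l2 -> l1.1 < l2.1 < l1.1 + 1 / 2 ->
  exists l3, P l3 /\ l3.1 = l1.1 + 1 / 2.
Proof.
move=> P1 P2 h12.
have c2 : in_cell N false (l1.1 + 1 / 2) l2 by rewrite /in_cell /cell_start; plra.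
have [_ [l3 [P3 c3 h23]]] := next_freq P2 c2.
exists l3; split => //; apply: contrapT => /eqP h3.
have {}h3 : l1.1 < l3.1 < l1.1 + 1 / 2.
  by move: c3 h3; rewrite /in_cell /cell_start neq_lt => ? /orP[]; plra.
pose x := Num.max l2.1 l3.1.
have [x2 x3 xu] : [/\ l2.1 <= x, l3.1 <= x & x < l1.1 + 1 / 2].
  by rewrite /x le_max lexx le_max lexx orbT gt_max; split => //; plra.
have cov l f : l.1 <= x < l.1 + 1 / 2 -> covers N x (l.1, f).
  by move=> ?; left; rewrite /in_cell /cell_start/=; plra.
have main f1 f2 f3 : P (l1.1, f1) -> P (l2.1, f2) -> P (l3.1, f3) ->
    f2 < f3 -> `|f1 - f2| < 2 -> `|f1 - f3| < 2 -> `|f2 - f3| < 2 -> False.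
  move=> Q1 Q2 Q3 d23 e12 e13 e23.
  apply: (@no_three x (l1.1, f1) (l2.1, f2) (l3.1, f3)) => //.
  - by move=> []; plra.
  - by move=> [] _; lra.
  - by move=> []; plra.
  - by apply: cov; plra.
  - by apply: cov; plra.
  - by apply: cov; plra.
(* The frequencies of l2 and l3 are less than 2 apart. The lower of l1 and the pair l2, l3 is raised
   by multiples of 2 towards the other; one extra shift of l1 by 2 is needed when it ends up at
   least 2 below l3. *)
have [h|h] := leP l1.2 l2.2.
  have [n [Pn hn]] := shift_freq_near h P1.
  have [h'|h'] := ltP (l3.2 - 2) (l1.2 + 2 * n%:R).
    by apply: (main _ l2.2 l3.2 Pn); rewrite -?surjective_pairing ?ltr_norml; try plra.
  have := shift_freq n.+1 P1; rewrite -[n.+1%:R]natr1 => Pn1.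
  by apply: (main _ l2.2 l3.2 Pn1); rewrite -?surjective_pairing ?ltr_norml; try plra.
have [n [Pn hn]] := shift_freq_near (ltW h) P2.
have Q3 := shift_freq n P3.
have [h'|h'] := ltP (l3.2 + 2 * n%:R - 2) l1.2.
  by apply: (main l1.2 _ _ _ Pn Q3); rewrite -?surjective_pairing ?ltr_norml; try plra.
have Q1 := shift_freq 1 P1.
by apply: (main (l1.2 + 2 * 1) _ _ Q1 Pn Q3); rewrite ?ltr_norml; try plra.
Qed.

(** A proper overlap reproduces itself 1/2 further to the right. After N steps a first half cell
    starts at l1.1 + N/2, where the second half of l1 starts too, against [in_cell_type]. *)
Lemma no_overlap l1 l2 : P l1 -> P l2 -> ~ (l1.1 < l2.1 < l1.1 + 1 / 2).
Proof.
move=> P1 P2 h12.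
have [l3 [P3 h3]] : exists l3, P l3 /\ l3.1 = l1.1 + N%:R / 2.
  have iter (n : nat) : exists l l', [/\ P l, P l', l.1 = l1.1 + n%:R / 2
      & l.1 < l'.1 < l.1 + 1 / 2].
    elim: n => [|n [l [l' [Pl Pl' e h]]]].
      by exists l1, l2; rewrite mul0r; split => //; plra.
    (* The successor l3 of l overlaps l' in turn, so l' also has a successor l4, and the pair l3, l4
       is the pair l, l' moved by 1/2. *)
    have [l3 [P3 e3]] := overlap_step Pl Pl' h.
    have h3 : l'.1 < l3.1 < l'.1 + 1 / 2 by plra.
    have [l4 [P4 e4]] := overlap_step Pl' P3 h3.
    by exists l3, l4; rewrite -[n.+1%:R]natr1; split => //; plra.
  by have [l [_ [Pl _ e _]]] := iter N; exists l.
have := @in_cell_type (l1.1 + N%:R / 2) true false l1 l3 P1 P3.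
by rewrite /in_cell /cell_start h3 => H; discriminate H; plra.
Qed.

Lemma in_cell_time b x la la' : P la -> P la' ->
  in_cell N b x la -> in_cell N b x la' -> la.1 = la'.1.
Proof.
move=> Pl Pl' c c'; have n1 := no_overlap Pl Pl'; have n2 := no_overlap Pl' Pl.
apply/eqP; rewrite eq_le !leNgt; apply/andP; split; apply/negP => h;
  [apply: n2|apply: n1]; move: c c'; rewrite /in_cell /cell_start; plra.
Qed.

Lemma covers_time x la la' : P la -> P la' ->
  covers N x la -> covers N x la' -> la.1 = la'.1.
Proof.
move=> Pl Pl' [] c [] c'; have bb := in_cell_type Pl Pl' c c';
  by [discriminate bb | apply: in_cell_time c c'].
Qed.

(** These are the left endpoints of all half cells, first and second alike. Half cells with
    endpoints closer than 1/2 coincide and together they cover the line, so the endpoints form a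
    single coset of Z/2. *)
Let starts : set R := [set s | exists la b, P la /\ s = cell_start N b la].

Let starts_eq s s' : starts s -> starts s' -> `|s - s'| < 1 / 2 -> s = s'.
Proof.
move=> [la [b [Pl ->]]] [la' [b' [Pl' ->]]]; rewrite ltr_norml => h.
pose x := Num.max (cell_start N b la) (cell_start N b' la').
have [] : in_cell N b x la /\ in_cell N b' x la'.
  rewrite /in_cell /x !le_max !gt_max !lexx orbT; split; plra.
move=> c c'; have bb := in_cell_type Pl Pl' c c'; subst b'.
by have e := in_cell_time Pl Pl' c c'; rewrite /cell_start e.
Qed.

Let starts_cover x : exists s, starts s /\ s <= x < s + 1 / 2.
Proof.
have [la [_ [Pl _ _ [c _] _]]] := two_per_window x 0.
case: c => c; [exists (cell_start N false la)|exists (cell_start N true la)];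
  by split => //; exists la; eexists.
Qed.

Let starts_succ s : starts s -> starts (s + 1 / 2).
Proof.
move=> Ss; have [s' [Ss' h]] := starts_cover (s + 1 / 2).
suff <- : s' = s + 1 / 2 by [].
apply: contrapT => /eqP ne.
have e : s' = s.
  by apply: starts_eq => //; move: ne; rewrite neq_lt ltr_norml => /orP[]; plra.
by move: h; rewrite e; plra.
Qed.

Let starts_pred s : starts s -> starts (s - 1 / 2).
Proof.
move=> Ss; have [s' [Ss' h]] := starts_cover (s - 1 / 2).
suff <- : s' = s - 1 / 2 by [].
have e : s' + 1 / 2 = s.
  by apply: starts_eq => //; [exact: starts_succ|rewrite ltr_norml; plra].
plra.
Qed.

Let starts_int s (k : int) : starts s -> starts (s + k%:~R / 2).
Proof.
have nat_case (n : nat) : starts s -> starts (s + n%:R / 2) /\ starts (s - n%:R / 2).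
  move=> Ss; elim: n => [|n [IH1 IH2]]; first by rewrite mul0r addr0 subr0.
  split.
  - have := starts_succ IH1; congr starts; rewrite -[n.+1%:R]natr1; plra.
  - have := starts_pred IH2; congr starts; rewrite -[n.+1%:R]natr1; plra.
move=> Ss; case: k => n; first by have [] := nat_case n Ss.
have [_] := nat_case n.+1 Ss.
by rewrite NegzE rmorphN/= mulNr.
Qed.

Lemma starts_lattice : exists tau, 0 <= tau < 1 / 2 /\
  forall s, (exists la b, P la /\ s = cell_start N b la) <->
            exists k : int, s = tau + k%:~R / 2.
Proof.
have [s0 [Ss0 _]] := starts_cover 0.
pose tau := s0 - (Num.floor (2 * s0))%:~R / 2.
have Stau : starts tau.
  by have := @starts_int s0 (- Num.floor (2 * s0)) Ss0; rewrite rmorphN/= mulNr.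
have near s : exists k : int, tau + k%:~R / 2 <= s < tau + k%:~R / 2 + 1 / 2.
  exists (Num.floor (2 * (s - tau))).
  have := floor_itv (2 * (s - tau)); rewrite intrD; plra.
exists tau; split.
  have := floor_itv (2 * s0); rewrite intrD /tau; plra.
move=> s; split=> [Ss|[k ->]]; last exact: starts_int.
have [k hk] := near s; exists k; apply: starts_eq => //; first exact: starts_int.
by rewrite ltr_norml; plra.
Qed.

(** A shift of f' by an even integer changes N (f - f') by an integer. After shifting f' to within 2
    of f, either the two agree or orthogonality makes N times their difference odd. *)
Lemma fiber_diff t f f' : P (t, f) -> P (t, f') ->
  exists k : int, N%:R * (f - f') = k%:~R.
Proof.
wlog h : f f' / f' <= f => [wl Pf Pf'|Pf Pf'].
  have [h|h] := leP f' f; first exact: wl h Pf Pf'.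
  have [k hk] := wl _ _ (ltW h) Pf' Pf; exists (- k).
  by rewrite rmorphN/= -hk; plra.
have [n [/= Pn hn]] := @shift_freq_near (t, f) (t, f') h Pf'.
have c g : covers N t (t, g) by left; rewrite /in_cell /cell_start/=; plra.
have [e|ne] := eqVneq f (f' + 2 * n%:R).
  by exists (N * 2 * n)%N%:Z; rewrite e -pmulrn !natrM; plra.
have /= [//||k hk] := @covers_near t (t, f) (t, f' + 2 * n%:R) Pf Pn _ (c _) (c _).
- by move=> [] /eqP; apply/negP.
- by rewrite ltr_norml; plra.
exists (2 * k + 1 + (N * 2 * n)%N%:Z).
by rewrite !rmorphD rmorphM/= -hk -[(Posz _)%:~R]pmulrn !natrM; plra.
Qed.

(** Apply the window property at the point t: it is covered by (t, f0), so [covers_time] gives both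
    elements found there the time t. *)
Lemma fiber_window t f0 a : P (t, f0) -> exists f f',
  [/\ P (t, f), P (t, f'), 0 <= a - f < 2, 0 <= a - f' < 2
    & exists k : int, N%:R * (f - f') = 2 * k%:~R + 1].
Proof.
move=> P0; have [la [la' [Pl Pl' ne [c c'] [w w']]]] := two_per_window t a.
have c0 : covers N t (t, f0) by left; rewrite /in_cell /cell_start/=; plra.
have /= e := covers_time P0 Pl c0 c; have /= e' := covers_time P0 Pl' c0 c'.
exists la.2, la'.2; rewrite {1}e e' -!surjective_pairing; split=> //.
apply: (covers_near Pl Pl' ne c c').
by rewrite ltr_norml; plra.
Qed.

End Packing.

(** * Inner products of Gabor elements *)

Section GaborInner.
Context {R : realType}.
Local Notation mu := (@lebesgue_measure R).
Local Notation Re := complex.Re.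
Local Notation Im := complex.Im.

(** The real factor r allows the half cell, of measure 1/2, to be normalized by the square root of
    2. *)
Definition window (r : R) (A : set R) (x : R) : R[i] := Complex (r * \1_A x) 0.

Lemma charfun_window (A : set R) : charfun A = window 1 A.
Proof. by apply/funext => x; rewrite /window mul1r. Qed.

Lemma continuous_exponential (xi : R) :
  continuous (fun x : R => Re (exponential xi x)) /\
  continuous (fun x : R => Im (exponential xi x)).
Proof. by split; [exact: continuous_cos_lin|exact: continuous_sin_lin]. Qed.

Lemma exponential_integrable (A : set R) (a b xi : R) :
  measurable (A : set (measurableTypeR R)) -> A `<=` `[a, b[ ->
  mu.-integrable A (EFin \o (fun x => Re (exponential xi x))) /\
  mu.-integrable A (EFin \o (fun x => Im (exponential xi x))).
Proof.
move=> mA Aab; have [c1 c2] := continuous_exponential xi.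
by split; apply: (@integrableS _ (measurableTypeR R) _ mu `[a, b[%classic) => //;
  exact: continuous_itv_integrable.
Qed.

Lemma cintegralD (A B : set R) (a b xi : R) :
  measurable (A : set (measurableTypeR R)) ->
  measurable (B : set (measurableTypeR R)) ->
  A `|` B `<=` `[a, b[ -> A `&` B = set0 ->
  cintegral (A `|` B) (exponential xi) =
  cintegral A (exponential xi) + cintegral B (exponential xi).
Proof.
move=> mA mB sAB dAB.
have [i1 i2] := exponential_integrable xi (measurableU _ _ mA mB) sAB.
have dj : [disjoint A & B] by apply/disj_setPS; rewrite dAB.
by apply: complex_ext; rewrite ?cReD ?cImD /cintegral /=;
  apply: Rintegral_setU.
Qed.

Lemma gabor_mul_conj r s (U V : set R) (la la' : R * R) x :
  gabor (window r U) la x * conjc (gabor (window s V) la' x) =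
  Complex (r * s * \1_[set x | U (x - la.1) /\ V (x - la'.1)] x) 0 *
  exponential (la.2 - la'.2) x.
Proof.
rewrite /gabor /window /exponential.
have -> : 2 * pi * (la.2 - la'.2) * x = 2 * pi * x * la.2 - 2 * pi * x * la'.2 by ring.
rewrite expiD -conjc_expi.
have -> : (\1_[set x | U (x - la.1) /\ V (x - la'.1)] x : R) =
    \1_U (x - la.1) * \1_V (x - la'.1).
  have i1 (B : set R) y : B y -> \1_B y = 1 :> R by move=> By; rewrite indicE mem_set.
  have i0 (B : set R) y : ~ B y -> \1_B y = 0 :> R by move=> By; rewrite indicE memNset.
  have [hU|hU] := pselect (U (x - la.1)); last first.
    by rewrite [X in _ = X * _]i0// mul0r i0// => -[].
  have [hV|hV] := pselect (V (x - la'.1)); last first.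
    by rewrite [X in _ = _ * X]i0// mulr0 i0// => -[].
  by rewrite !i1// mulr1.
by apply: complex_ext; rewrite !(cReM, cImM, cReJ, cImJ) /=; ring.
Qed.

Lemma inner_gabor r s (U V : set R) (la la' : R * R) (a b : R) :
  measurable ([set x | U (x - la.1) /\ V (x - la'.1)] : set (measurableTypeR R)) ->
  [set x | U (x - la.1) /\ V (x - la'.1)] `<=` `[a, b[ ->
  inner setT (gabor (window r U) la) (gabor (window s V) la') =
  Complex (r * s) 0 * cintegral [set x | U (x - la.1) /\ V (x - la'.1)]
    (exponential (la.2 - la'.2)).
Proof.
move=> mA sA; set A := [set x | _] in mA sA *.
have [i1 i2] := exponential_integrable (la.2 - la'.2) mA sA.
apply: complex_ext.
- transitivity (r * s * \int[mu]_(x in A) Re (exponential (la.2 - la'.2) x)).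
    rewrite -RintegralZl// [RHS]Rintegral_mkcond; apply: eq_Rintegral => x _.
    rewrite gabor_mul_conj cReM [Re (Complex _ _)]/= [Im (Complex _ _)]/=.
    rewrite mul0r subr0 -/A patchE indicE.
    by case: (x \in A); rewrite ?mulr1 ?mulr0 ?mul0r.
  by rewrite cReM [Re (Complex _ _)]/= [Im (Complex _ _)]/= mul0r subr0.
- transitivity (r * s * \int[mu]_(x in A) Im (exponential (la.2 - la'.2) x)).
    rewrite -RintegralZl// [RHS]Rintegral_mkcond; apply: eq_Rintegral => x _.
    rewrite gabor_mul_conj cImM [Re (Complex _ _)]/= [Im (Complex _ _)]/=.
    rewrite mul0r addr0 -/A patchE indicE.
    by case: (x \in A); rewrite ?mulr1 ?mulr0 ?mul0r.
  by rewrite cImM [Re (Complex _ _)]/= [Im (Complex _ _)]/= mul0r addr0.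
Qed.

Lemma inL2_gabor r (U : set R) (la : R * R) (a b : R) :
  measurable (U : set (measurableTypeR R)) -> U `<=` `[a, b[ ->
  inL2 setT (gabor (window r U) la).
Proof.
move=> mU sU.
have mi : measurable_fun setT (fun x : R => r * \1_U (x - la.1) : R).
  apply: measurable_funM => //.
  apply: (measurableT_comp (measurable_indic mU)).
  exact: measurable_funB.
have mc w : measurable_fun setT (fun x : R => cos (w * x)).
  by apply: continuous_measurable_fun; exact: continuous_cos_lin.
have ms w : measurable_fun setT (fun x : R => sin (w * x)).
  by apply: continuous_measurable_fun; exact: continuous_sin_lin.
split.
- have -> : (fun x => Re (gabor (window r U) la x)) =
     (fun x => (r * \1_U (x - la.1)) * cos (2 * pi * la.2 * x)).
    apply/funext => x; rewrite /gabor cReM /= mul0r subr0; congr (_ * cos _); ring.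
  exact: measurable_funM.
- have -> : (fun x => Im (gabor (window r U) la x)) =
     (fun x => (r * \1_U (x - la.1)) * sin (2 * pi * la.2 * x)).
    apply/funext => x; rewrite /gabor cImM /= mul0r addr0; congr (_ * sin _); ring.
  exact: measurable_funM.
- rewrite /sqnorm2.
  apply: (@le_lt_trans _ _ (\int[mu]_(x in `[(a + la.1)%R, (b + la.1)%R[) (r ^+ 2)%:E)%E).
    rewrite [leRHS]integral_mkcond.
    apply: ge0_le_integral => //.
    + by move=> x _; rewrite lee_fin csqnorm_ge0.
    + have -> : (fun x => (csqnorm (gabor (window r U) la x))%:E) =
         (fun x => ((r * \1_U (x - la.1)) ^+ 2)%:E).
        apply/funext => x; congr EFin; rewrite /gabor csqnormM csqnorm_expi mulr1.
        by rewrite /csqnorm /= expr0n addr0.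
      by apply/measurable_EFinP; exact: measurable_funX.
    + by apply/(measurable_restrictT _ _).1 => //; exact: measurable_cst.
    move=> x _; rewrite /gabor csqnormM csqnorm_expi mulr1.
    rewrite /csqnorm /= expr0n addr0 patchE indicE.
    case: (pselect (U (x - la.1))) => hU.
      rewrite mem_set// mulr1 mem_set//=.
      by move: (sU _ hU); rewrite /= !in_itv/=; lra.
    rewrite memNset// mulr0 expr0n /=; case: ifP => _ //.
    by rewrite lee_fin sqr_ge0.
  rewrite integral_cst//= lebesgue_measure_itv/=.
  by case: ifP => _; rewrite -?EFinB -?EFinM ?mule0 ltry.
Qed.

End GaborInner.

(** * Overlaps of half cells and the resulting orthogonality relations *)

Section TwoIntervals.
Context {R : realType} (N : nat).
Hypothesis N2 : (2 <= N)%N.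
Local Notation mu := (@lebesgue_measure R).

Definition halfcell : set R := `[0, 1 / 2[.
(** This is [OmegaS] at alpha = 1/2 with N = 2 beta + 1, since 1/2 + beta = N/2. *)
Definition twocells : set R := `[0, 1 / 2[ `|` `[N%:R / 2, N%:R / 2 + 1 / 2[.

Let NR : 2 <= N%:R :> R. Proof. by rewrite ler_nat. Qed.

Lemma twocells_covers x (la : R * R) : twocells (x - la.1) <-> covers N x la.
Proof.
rewrite /twocells /covers /in_cell /cell_start /= !in_itv /=.
by split => -[] h; [left|right|left|right]; lra.
Qed.

Lemma measurable_twocells : measurable (twocells : set (measurableTypeR R)).
Proof. by apply: measurableU; exact: measurable_itv. Qed.

Lemma twocells_sub : twocells `<=` `[0, N%:R / 2 + 1 / 2[.
Proof. by move=> x; rewrite /twocells /= !in_itv /= => -[]; have := NR; lra. Qed.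

Lemma overlap_near (la la' : R * R) : `|la.1 - la'.1| < 1 / 2 ->
  exists a b, [/\ a < b, b - a = 1 / 2 - `|la.1 - la'.1|, b <= a + N%:R / 2 &
   [set x | twocells (x - la.1) /\ twocells (x - la'.1)] =
   `[a, b[ `|` `[a + N%:R / 2, b + N%:R / 2[].
Proof.
wlog h : la la' / la.1 <= la'.1 => [wl d|d].
  have [h|h] := leP la.1 la'.1; first exact: wl h d.
  have [|a [b [ab eab abN e]]] := wl la' la (ltW h); first by rewrite distrC.
  exists a, b; split => //; first by rewrite eab distrC.
  by rewrite -e; apply/seteqP; split => x [].
exists la'.1, (la.1 + 1 / 2); move: (d); rewrite ler0_norm ?subr_le0// => d'.
have := NR => NR'; split; [lra|lra|lra|].
apply/seteqP; split => x /=; rewrite !in_itv/=.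
  rewrite !twocells_covers /covers /in_cell /cell_start /=.
  by move=> [[] h1 [] h2]; try (exfalso; lra); [left|right]; lra.
rewrite !twocells_covers /covers /in_cell /cell_start /=.
by move=> [] h1; split; [left|left|right|right]; lra.
Qed.

Lemma overlap_far (la la' : R * R) : `|la.1 - la'.1 - N%:R / 2| < 1 / 2 ->
  exists a b, [/\ a < b, b - a = 1 / 2 - `|la.1 - la'.1 - N%:R / 2| &
   [set x | twocells (x - la.1) /\ twocells (x - la'.1)] = `[a, b[%classic].
Proof.
have := NR => NR' d.
have [h|h] := leP 0 (la.1 - la'.1 - N%:R / 2).
- exists la.1, (la'.1 + N%:R / 2 + 1 / 2).
  move: (d); rewrite ger0_norm// => d'; split; [lra|lra|].
  apply/seteqP; split => x /=; rewrite !in_itv/=;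
    rewrite !twocells_covers /covers /in_cell /cell_start /=.
    by move=> [[] h1 [] h2]; lra.
  by move=> h1; split; [left|right]; lra.
- exists (la'.1 + N%:R / 2), (la.1 + 1 / 2).
  move: (d); rewrite ltr0_norm// => d'; split; [lra|lra|].
  apply/seteqP; split => x /=; rewrite !in_itv/=;
    rewrite !twocells_covers /covers /in_cell /cell_start /=.
    by move=> [[] h1 [] h2]; lra.
  by move=> h1; split; [left|right]; lra.
Qed.

Lemma csqnorm_eq0 (c : R[i]) : csqnorm c = 0 -> c = 0.
Proof.
case: c => a b; rewrite /csqnorm /= => /eqP.
by rewrite paddr_eq0 ?sqr_ge0// !sqrf_eq0 => /andP[/eqP -> /eqP ->].
Qed.

Lemma csqnorm0 : csqnorm (0 : R[i]) = 0.
Proof. by rewrite /csqnorm /= expr0n addr0. Qed.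

(** The supports overlap in an interval and its translate by N/2. The inner product thus factors as
    1 + exp(i pi N xi), with xi the frequency difference, times the integral over the first
    interval, and one of the two factors vanishes. *)
Lemma orthogonal_near (la la' : R * R) : `|la.1 - la'.1| < 1 / 2 ->
  inner setT (gabor (charfun twocells) la) (gabor (charfun twocells) la') = 0 ->
  la.2 - la'.2 != 0 /\
  ((exists k : int, (la.2 - la'.2) * (1 / 2 - `|la.1 - la'.1|) = k%:~R) \/
  (exists k : int, N%:R * (la.2 - la'.2) = 2 * k%:~R + 1)).
Proof.
move=> d; have [a [b [ab eab abN e]]] := overlap_near d.
have mI c c' : measurable (`[c, c'[ : set (measurableTypeR R)) by exact: measurable_itv.
have := NR => NR'.
rewrite charfun_window (@inner_gabor _ _ _ _ _ _ _ a (b + N%:R / 2)).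
- rewrite e mulr1 => h.
  have {h} : csqnorm (cintegral (`[a, b[ `|` `[a + N%:R / 2, b + N%:R / 2[)
      (exponential (la.2 - la'.2))) = 0.
    move/(congr1 (@csqnorm R)): h; rewrite csqnormM csqnorm0 {1}/csqnorm /=.
    by rewrite expr1n expr0n addr0 mul1r.
  rewrite (@cintegralD _ _ _ a (b + N%:R / 2))//; last 2 first.
  + by move=> x /=; rewrite !in_itv/=; lra.
  + by apply/seteqP; split => x //=; rewrite !in_itv/=; lra.
  rewrite int_exponential_shift ?(ltW ab)// -[X in X + _]mul1r -mulrDl csqnormM.
  rewrite csqnorm_int_exponential ?(ltW ab)//.
  move=> /eqP; rewrite mulf_eq0 => /orP[] /eqP.
  + have -> : 2 * pi * (la.2 - la'.2) * (N%:R / 2) = pi * (N%:R * (la.2 - la'.2)).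
      by field.
    move=> /one_add_expi_eq0 [k hk]; split; last by right; exists k.
    apply/eqP => h0; move: hk; rewrite h0 mulr0 => hk.
    have : ((2 * k + 1)%:~R : R) = 0%:~R by rewrite rmorphD rmorphM/= -hk.
    by move/intr_inj; lia.
  + move=> /kappa_eq0 []; first by lra.
    by move=> x0 hk; split => //; left; rewrite -eab.
- by rewrite e; apply: measurableU.
- by rewrite e => x /=; rewrite !in_itv/=; lra.
Qed.

Lemma orthogonal_far (la la' : R * R) : `|la.1 - la'.1 - N%:R / 2| < 1 / 2 ->
  inner setT (gabor (charfun twocells) la) (gabor (charfun twocells) la') = 0 ->
  la.2 - la'.2 != 0 /\
  exists k : int, (la.2 - la'.2) * (1 / 2 - `|la.1 - la'.1 - N%:R / 2|) = k%:~R.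
Proof.
move=> d; have [a [b [ab eab e]]] := overlap_far d.
rewrite charfun_window (@inner_gabor _ _ _ _ _ _ _ a b).
- rewrite e mulr1 => h.
  have {h} : csqnorm (cintegral `[a, b[ (exponential (la.2 - la'.2))) = 0.
    move/(congr1 (@csqnorm R)): h; rewrite csqnormM csqnorm0 {1}/csqnorm /=.
    by rewrite expr1n expr0n addr0 mul1r.
  rewrite csqnorm_int_exponential ?(ltW ab)// => /kappa_eq0 []; first by lra.
  by move=> x0 hk; split => //; rewrite -eab.
- by rewrite e; exact: measurable_itv.
- by rewrite e.
Qed.

(** For N >= 2 at most one of the two tent functions is nonzero: a half cell shifted by u meets
    [twocells] in a single interval, of this length. *)
Definition overlap_len (u : R) : R :=
  Num.max 0 (1 / 2 - `|u|) + Num.max 0 (1 / 2 - `|u - N%:R / 2|).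

Lemma halfcell_overlap (z la : R * R) : exists a b,
  [/\ a <= b, b - a = overlap_len (z.1 - la.1) &
  [set x | halfcell (x - z.1) /\ twocells (x - la.1)] = `[a, b[%classic].
Proof.
have := NR => NR'; rewrite /overlap_len; set u := z.1 - la.1.
have e0 v : 1 / 2 <= `|v| -> Num.max 0 (1 / 2 - `|v|) = 0 :> R.
  by move=> h; apply/max_idPl; lra.
have e1 v : `|v| < 1 / 2 -> Num.max 0 (1 / 2 - `|v|) = 1 / 2 - `|v| :> R.
  by move=> h; apply/max_idPr; lra.
have AE x : (halfcell (x - z.1) /\ twocells (x - la.1)) <->
    (0 <= x - z.1 < 1 / 2 /\ covers N x la).
  by rewrite twocells_covers /halfcell /= in_itv/=.
have single c : `|z.1 - c| < 1 / 2 -> exists a b, [/\ a <= b,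
    b - a = 1 / 2 - `|z.1 - c| & forall x,
      a <= x < b <-> (0 <= x - z.1 < 1 / 2 /\ c <= x < c + 1 / 2)].
  have [h|h] := leP 0 (z.1 - c) => d.
    exists z.1, (c + 1 / 2); move: d; rewrite ger0_norm// => d.
    by split; [lra..|move=> x; split; lra].
  exists c, (z.1 + 1 / 2); move: d; rewrite ltr0_norm// => d.
  by split; [lra..|move=> x; split; lra].
have [d|d] := ltP `|u| (1 / 2).
  have [a [b [ab eab H]]] := single la.1 d.
  exists a, b; rewrite e1// e0; last first.
    by rewrite ler_normr; move: d; rewrite ltr_norml; lra.
  split => //; first by rewrite addr0.
  apply/seteqP; split => x /=.
    move=> /AE [h1]; rewrite in_itv/= H /covers /in_cell /cell_start /=.
    by move: d; rewrite ltr_norml /u; lra.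
  rewrite in_itv/= => /H h; apply/AE; split; first lra.
  by left; rewrite /in_cell /cell_start /=; lra.
have [d'|d'] := ltP `|u - N%:R / 2| (1 / 2).
  have uE : u - N%:R / 2 = z.1 - (la.1 + N%:R / 2) by rewrite /u; ring.
  rewrite e0// e1// uE; rewrite uE in d'.
  have [a [b [ab eab H]]] := single _ d'.
  exists a, b; split => //; first by rewrite add0r.
  apply/seteqP; split => x /=.
    move=> /AE [h1]; rewrite in_itv/= H /covers /in_cell /cell_start /=.
    by move: d'; rewrite ltr_norml; lra.
  rewrite in_itv/= => /H h; apply/AE; split; first lra.
  by right; rewrite /in_cell /cell_start /=; lra.
exists 0, 0; rewrite !e0// addr0 subr0 set_itvco0; split => //.
apply/seteqP; split => x //= /AE [h1]; rewrite /covers /in_cell /cell_start/=.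
by move: d d'; rewrite !ler_normr /u; lra.
Qed.

(* The function phi of the header: [|<h_z, g>|^2] with [h] and [g] the indicators
   of [halfcell] and [twocells]. *)
Definition overlap_kernel (z : R * R) : R := kappa (overlap_len z.1) z.2.

Lemma inner_halfcell r (z la : R * R) :
  csqnorm (inner setT (gabor (window r halfcell) z) (gabor (charfun twocells) la))
  = r ^+ 2 * overlap_kernel (z - la).
Proof.
have [a [b [ab eab e]]] := halfcell_overlap z la.
rewrite charfun_window (@inner_gabor _ _ _ _ _ _ _ a b).
- rewrite e mulr1 csqnormM csqnorm_int_exponential// eab {1}/csqnorm /=.
  by rewrite expr0n addr0.
- by rewrite e; exact: measurable_itv.
- by rewrite e.
Qed.

Lemma kappaN l xi : kappa l (- xi) = kappa l xi :> R.
Proof.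
rewrite /kappa oppr_eq0; case: eqVneq => // _.
by rewrite mulrN mulNr sinN invrN mulrNN.
Qed.

(** This version expands the two-cell window against half cells, the direction needed for Bessel's
    inequality over [half_lattice]; [inner_halfcell] serves Parseval over the given basis. *)
Lemma inner_halfcellr r (z la : R * R) :
  csqnorm (inner setT (gabor (charfun twocells) la) (gabor (window r halfcell) z))
  = r ^+ 2 * overlap_kernel (z - la).
Proof.
have [a [b [ab eab e]]] := halfcell_overlap z la.
have e' : [set x | twocells (x - la.1) /\ halfcell (x - z.1)] = `[a, b[%classic.
  by rewrite -e; apply/seteqP; split => x [].
rewrite charfun_window (@inner_gabor _ _ _ _ _ _ _ a b).
- rewrite e' mul1r csqnormM csqnorm_int_exponential// eab {1}/csqnorm /=.
  by rewrite expr0n addr0 /overlap_kernel /= -kappaN opprB.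
- by rewrite e'; exact: measurable_itv.
- by rewrite e'.
Qed.

Lemma measurable_halfcell : measurable (halfcell : set (measurableTypeR R)).
Proof. exact: measurable_itv. Qed.

Lemma nrm2_halfcell r (z : R * R) :
  nrm2 setT (gabor (window r halfcell) z) = r ^+ 2 / 2.
Proof.
have e : [set x | halfcell (x - z.1) /\ halfcell (x - z.1)] =
    `[z.1, z.1 + 1 / 2[%classic.
  apply/seteqP; split => x /=; rewrite /halfcell /= !in_itv/=; first lra.
  by move=> ?; split; lra.
have := inner_self (D := [set: R]) measurableT (gabor (window r halfcell) z).
rewrite (@inner_gabor _ _ _ _ _ _ _ z.1 (z.1 + 1 / 2)).
- rewrite e subrr int_exponential0; last by lra.
  by move/(congr1 (@complex.Re R)); rewrite cReM /= => <-; field.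
- by rewrite e; exact: measurable_itv.
- by rewrite e.
Qed.

Lemma nrm2_twocells (la : R * R) : nrm2 setT (gabor (charfun twocells) la) = 1.
Proof.
have := NR => NR'.
have e : [set x | twocells (x - la.1) /\ twocells (x - la.1)] =
    `[la.1, la.1 + 1 / 2[ `|` `[la.1 + N%:R / 2, la.1 + 1 / 2 + N%:R / 2[.
  apply/seteqP; split => x /=; rewrite !twocells_covers /covers /in_cell /cell_start/= !in_itv/=.
    by move=> [] [] h _; [left|right]; lra.
  by move=> [] h; split; by [left; lra|right; lra].
have := inner_self (D := [set: R]) measurableT (gabor (charfun twocells) la).
rewrite charfun_window (@inner_gabor _ _ _ _ _ _ _ la.1 (la.1 + 1 / 2 + N%:R / 2)).
- rewrite e subrr (@cintegralD _ _ _ la.1 (la.1 + 1 / 2 + N%:R / 2)).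
  + rewrite !int_exponential0; [|lra..].
    by move/(congr1 (@complex.Re R)); rewrite cReM /= => <-; field.
  + exact: measurable_itv.
  + exact: measurable_itv.
  + by move=> x /=; rewrite !in_itv/=; lra.
  + by apply/seteqP; split => x //=; rewrite !in_itv/=; lra.
- by rewrite e; apply: measurableU; exact: measurable_itv.
- by rewrite e => x /=; rewrite !in_itv/=; lra.
Qed.

End TwoIntervals.

(** * Exchanging sums over the system with integrals over the plane *)

(** Turns sums over a countable set into series indexed by naturals, to which monotone convergence
    applies. *)
Lemma countable_enum (T : pointedType) (A : set T) : countable A ->
  exists (P : set nat) (e : nat -> T), set_inj P e /\ A = [set e n | n in P].
Proof.
move=> /countable_injP[f fi].
pose e n := xget point [set a | A a /\ f a = n].
have eP a : A a -> e (f a) = a.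
  move=> Aa; have [Ae fe] : [set b | A b /\ f b = f a] (e (f a)).
    exact: (@xgetPex _ point [set b | A b /\ f b = f a]) (ex_intro _ a _).
  by apply: fi; rewrite ?inE.
exists (f @` A), e; split.
  by move=> n m; rewrite !inE => -[a Aa <-] [b Ab <-]; rewrite !eP// => ->.
apply/seteqP; split => [a Aa|a [_ [b Ab <-] <-]]; last by rewrite eP.
by exists (f a); [exists a|exact: eP].
Qed.

Section IntegralEsum.
Local Open Scope ereal_scope.
Context d (X : measurableType d) (R : realType) (m : {measure set X -> \bar R}).
Context (T : pointedType) (A : set T) (f : T -> X -> \bar R).
Hypothesis cA : countable A.
Hypothesis f0 : forall a x, 0 <= f a x.
Hypothesis mf : forall a, measurable_fun setT (f a).

Lemma measurable_esum : measurable_fun setT (fun x => \esum_(a in A) f a x).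
Proof.
have [P [e [ei ->]]] := countable_enum cA.
have -> : (fun x => \esum_(a in [set e n | n in P]) f a x) =
    (fun x => \sum_(n <oo | n \in mem P) f (e n) x).
  apply/funext => x.
  exact: esum_set_image (fun a => f a x) e P (fun n _ => f0 (e n) x) ei.
by apply: ge0_emeasurable_sum.
Qed.

Lemma integral_esum :
  \int[m]_x (\esum_(a in A) f a x) = \esum_(a in A) \int[m]_x f a x.
Proof.
have [P [e [ei ->]]] := countable_enum cA.
have sE x : \esum_(a in [set e n | n in P]) f a x =
    \sum_(n <oo) (if n \in P then f (e n) x else 0).
  have -> := esum_set_image (fun a => f a x) e P (fun n _ => f0 (e n) x) ei.
  by rewrite eseries_mkcond.
under eq_integral do rewrite sE.
rewrite integral_nneseries//.
- have i0 n : P n -> 0 <= \int[m]_x f (e n) x by move=> _; exact: integral_ge0.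
  rewrite (esum_set_image (fun a => \int[m]_x f a x) e P i0 ei).
  rewrite [RHS]eseries_mkcond; apply: eq_eseriesr => n _.
  by case: ifP => // _; rewrite integral0.
- by move=> k; case: (k \in P); [exact: mf|exact: measurable_cst].
- by move=> k x _; case: ifP.
Qed.

End IntegralEsum.

(** * Translation invariance of Lebesgue measure on the line and the plane *)

Section Translation.
Local Open Scope ereal_scope.
Context {R : realType}.
Local Notation mu := (@lebesgue_measure R).
Local Notation plane := (measurableTypeR R * measurableTypeR R)%type.

Lemma lebesgue_measure_shift (c : R) (A : set (measurableTypeR R)) :
  measurable A ->
  pushforward mu ((fun x => x + c)%R : _ -> measurableTypeR R) A = mu A.
Proof.
move=> mA; apply/esym/lebesgue_measure_unique => //=.
  exact: measurable_funD.
move=> ms _ [[a b]] _ <-.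
rewrite /pushforward/=.
have -> : (fun x => x + c)%R @^-1` [set` Interval (BRight a) (BRight b)] =
   [set` Interval (BRight (a - c)%R) (BRight (b - c)%R)].
  by apply/seteqP; split => x /=; rewrite !in_itv/=; lra.
rewrite !lebesgue_measure_itv/= !lte_fin ltrD2r.
by case: ifP => // _; rewrite -!EFinB; congr EFin; ring.
Qed.

Lemma integral_shift (c : R) (f : R -> \bar R) :
  measurable_fun [set: measurableTypeR R] f -> (forall x, 0 <= f x) ->
  \int[mu]_x f (x + c)%R = \int[mu]_x f x.
Proof.
move=> mf f0.
have ms : measurable_fun [set: measurableTypeR R] ((fun x => x + c)%R : _ -> measurableTypeR R).
  exact: measurable_funD.
have := @ge0_integral_pushforward _ _ _ _ _ _ ms mu setT f measurableT mf
  (fun y _ => f0 y).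
rewrite preimage_setT => <-.
apply: eq_measure_integral => A mA _.
by rewrite -[RHS](lebesgue_measure_shift c)//; exact: mA.
Qed.

Lemma measurable_pair_subl (c : R * R) :
  measurable_fun setT (fun z : plane => (c - z)%R : plane).
Proof.
apply/measurable_fun_pairP; split.
- by apply: measurable_funB => //; exact: measurable_fst.
- by apply: measurable_funB => //; exact: measurable_snd.
Qed.

Lemma measurable_pair_subr (c : R * R) :
  measurable_fun setT (fun z : plane => (z - c)%R : plane).
Proof.
apply/measurable_fun_pairP; split.
- by apply: measurable_funB => //; exact: measurable_fst.
- by apply: measurable_funB => //; exact: measurable_snd.
Qed.

Definition mu2 := (mu \x mu)%E.

Lemma integral2_shift (c : R * R) (f : plane -> \bar R) :
  measurable_fun setT f -> (forall x, 0 <= f x) ->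
  \int[mu2]_z f (z + c)%R = \int[mu2]_z f z.
Proof.
move=> mf f0.
have ms : measurable_fun setT (fun z : plane => (z + c)%R : plane).
  apply/measurable_fun_pairP; split.
  - by apply: measurable_funD => //; exact: measurable_fst.
  - by apply: measurable_funD => //; exact: measurable_snd.
rewrite /mu2 (fubini_tonelli1 (fun z : plane => f (z + c)%R))//; last first.
  exact: measurableT_comp mf ms.
rewrite (fubini_tonelli1 f)//.
rewrite -[RHS](integral_shift c.1)//.
- apply: eq_integral => x _; rewrite /fubini_F.
  rewrite -[RHS](integral_shift c.2)//.
  exact: measurableT_comp mf (pair1_measurable _).
- exact: measurable_fun_fubini_tonelli_F.
- by move=> x; apply: integral_ge0.
Qed.

End Translation.

Section Exchange.
Local Open Scope ereal_scope.
Context {R : realType}.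
Local Notation mu := (@lebesgue_measure R).
Local Notation plane := (measurableTypeR R * measurableTypeR R)%type.

(* Tonelli and translation invariance: both sides integrate
   [f v * g (p - a - v)] over the plane and sum over [a]. *)
Lemma convolution_exchange (A : set (R * R)) (f g : R * R -> R) (p : R * R) :
  countable A ->
  measurable_fun [set: plane] f -> measurable_fun [set: plane] g ->
  (forall z, 0 <= f z)%R -> (forall z, 0 <= g z)%R ->
  \int[mu2]_v ((f v)%:E * \esum_(a in A) (g (p - a - v)%R)%:E) =
  \int[mu2]_z ((g (p - z)%R)%:E * \esum_(a in A) (f (z - a)%R)%:E).
Proof.
move=> cA mf mg f0 g0.
have mulE (x : R) (h : R * R -> R) : (0 <= x)%R -> (forall a, 0 <= h a)%R ->
    (x%:E * (\esum_(a in A) (h a)%:E) = \esum_(a in A) (x * h a)%:E)%E.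
  move=> x0 h0; have [P [e [ei ->]]] := countable_enum cA.
  have h1 n : P n -> 0 <= (h (e n))%:E by rewrite lee_fin.
  have h2 n : P n -> 0 <= (x * h (e n))%:E by rewrite lee_fin mulr_ge0.
  rewrite (esum_set_image (fun a => (h a)%:E) e P h1 ei).
  rewrite (esum_set_image (fun a => (x * h a)%:E) e P h2 ei).
  by rewrite -nneseriesZl// => i _; rewrite lee_fin.
under eq_integral do rewrite mulE//.
under [RHS]eq_integral do rewrite mulE//.
rewrite (@integral_esum _ _ _ mu2 _ A (fun (a : R * R) (v : plane) => (f v * g (p - a - v))%R%:E))//; last 2 first.
- by move=> a x; rewrite lee_fin mulr_ge0.
- move=> a; apply/measurable_EFinP; apply: measurable_funM => //.
  exact: measurableT_comp mg (measurable_pair_subl _).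
rewrite (@integral_esum _ _ _ mu2 _ A (fun (a : R * R) (v : plane) => (g (p - v) * f (v - a))%R%:E))//; last 2 first.
- by move=> a x; rewrite lee_fin mulr_ge0.
- move=> a; apply/measurable_EFinP; apply: measurable_funM => //.
    exact: measurableT_comp mg (measurable_pair_subl _).
  exact: measurableT_comp mf (measurable_pair_subr _).
apply: eq_esum => a _.
(* Substitute v = z - a, so that p - a - v becomes p - z. *)
rewrite -[LHS](integral2_shift (- a)%R); last 2 first.
- apply/measurable_EFinP; apply: measurable_funM => //.
  exact: measurableT_comp mg (measurable_pair_subl _).
- by move=> x; rewrite lee_fin mulr_ge0.
apply: eq_integral => z _; congr EFin; rewrite mulrC; congr (g _ * _)%R.
by rewrite opprD opprK addrA addrAC subrK.
Qed.
End Exchange.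

Section EsumFinite.
Context {R : realType} {T : choiceType} (A : set T) (f : T -> R).

Lemma esum_le_seq (c : R) :
  (forall S : seq T, uniq S -> (forall i, i \in S -> A i) ->
    \sum_(i <- S) f i <= c) ->
  (\esum_(i in A) (f i)%:E <= c%:E)%E.
Proof.
move=> H; apply: ge_ereal_sup => _ [X [finX XA] <-].
rewrite fsbig_finite// sumEFin lee_fin; apply: H => //.
by move=> i; rewrite in_fset_set// inE => /XA.
Qed.

Lemma esum_ge_seq (S : seq T) : uniq S -> (forall i, i \in S -> A i) ->
  ((\sum_(i <- S) f i)%:E <= \esum_(i in A) (f i)%:E)%E.
Proof.
move=> uS SA; apply: esum_ge; exists [set` S].
  by split; [exact: finite_seq|move=> i; exact: SA].
by rewrite -fsbig_seq// sumEFin.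
Qed.

End EsumFinite.

(** * Positivity and integral of the overlap kernel *)

Section Kernel.
Context {R : realType} (N : nat).
Hypothesis N2 : (2 <= N)%N.
Local Notation mu := (@lebesgue_measure R).
Local Notation plane := (measurableTypeR R * measurableTypeR R)%type.
Local Notation K := (@overlap_kernel R N).

Lemma measurable_overlap_kernel : measurable_fun [set: plane] K.
Proof.
have m1 : measurable_fun [set: plane] (fun z => z.1 : R) by exact: measurable_fst.
have m2 : measurable_fun [set: plane] (fun z => z.2 : R) by exact: measurable_snd.
have mlen : measurable_fun [set: plane] (fun z => overlap_len N z.1 : R).
  rewrite /overlap_len; apply: measurable_funD; apply: measurable_maxr => //;
    apply: measurable_funB => //; apply: measurableT_comp => //.
  exact: measurable_funB.
(* The reciprocal is written as a real power of a nonnegative base, where it agrees with the inverse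
   and is a measurable function. *)
rewrite (_ : K = fun z => if z.2 == 0 then overlap_len N z.1 ^+ 2
    else sin (pi * z.2 * overlap_len N z.1) ^+ 2 * ((pi * z.2) ^+ 2) `^ (-1)).
  apply: measurable_fun_ifT.
  - exact: measurable_fun_eqr.
  - exact: measurable_funX.
  - apply: measurable_funM.
    + apply: measurable_funX.
      apply: (measurableT_comp (f := (@sin R))).
        by apply: continuous_measurable_fun; exact: continuous_sin.
      by apply: measurable_funM => //; apply: measurable_funM.
    + apply: (measurableT_comp (f := (fun x => x `^ (-1)))) => //.
      by apply: measurable_funX; apply: measurable_funM.
apply/funext => z; rewrite /overlap_kernel /kappa; case: ifP => // _.
by rewrite powR_inv1 ?sqr_ge0// expr_div_n.
Qed.

Lemma overlap_kernel_ge0 z : 0 <= K z.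
Proof. by rewrite /overlap_kernel /kappa; case: ifP => _; exact: sqr_ge0. Qed.

(** The overlap length is positive and at most 1/2, so its product with the frequency has modulus
    below 1. A zero of [kappa] would make this product an integer, hence 0. *)
Lemma overlap_kernel_gt0 (z : R * R) : `|z.1| < 1 / 2 -> `|z.2| < 2 -> 0 < K z.
Proof.
move=> u xi; rewrite lt_neqAle overlap_kernel_ge0 andbT eq_sym.
have N2R : 2 <= N%:R :> R by rewrite ler_nat.
have lenE : overlap_len N z.1 = 1 / 2 - `|z.1|.
  rewrite /overlap_len (max_idPr _); last by lra.
  rewrite (max_idPl _) ?addr0//.
  by rewrite subr_le0 ler_normr; move: u; rewrite ltr_norml; lra.
apply/eqP; rewrite /overlap_kernel => /kappa_eq0 []; first by rewrite lenE; lra.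
move=> x0 [k hk].
have : `|z.2 * overlap_len N z.1| < 1.
  rewrite normrM lenE [`|1 / 2 - _|]ger0_norm; last by lra.
  have := normr_ge0 z.1; have := normr_ge0 z.2; nra.
rewrite hk -intr_norm -[1]/(1%:~R) ltr_int => k1.
have k0 : k = 0 by lia.
move: hk; rewrite k0 => /eqP; rewrite mulf_eq0 (negbTE x0) /= lenE => /eqP; lra.
Qed.

(* The translates of the half cell by this lattice are orthogonal, which bounds
   the integral of the kernel without computing any sinc integral. *)
Definition half_lattice : set (R * R) :=
  [set z | exists i j : int, z = (i%:~R / 2, 2 * j%:~R)].

Lemma countable_half_lattice : countable half_lattice.
Proof.
have -> : half_lattice =
    (fun p : int * int => (p.1%:~R / 2, 2 * p.2%:~R) : R * R) @` setT.
  apply/seteqP; split => [z [i [j ->]]|_ [[i j] _ <-]]; first by exists (i, j).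
  by exists i, j.
exact: sub_countable (card_image_le _ _) (countableP _).
Qed.

Lemma half_lattice_reduce (p : R * R) : exists2 a, half_lattice a &
  0 <= (p - a).1 < 1 / 2 /\ 0 <= (p - a).2 < 2.
Proof.
exists ((Num.floor (2 * p.1))%:~R / 2, 2 * (Num.floor (p.2 / 2))%:~R).
  by do 2 eexists.
have := floor_itv (2 * p.1); have := floor_itv (p.2 / 2).
by rewrite !intrD /=; lra.
Qed.

(** Different time indices give disjoint half cells. For equal times the frequencies differ by a
    nonzero even integer, and such an exponential integrates to 0 over an interval of length 1/2. *)
Lemma half_lattice_orthonormal (z : R * R) : orthonormal_family setT half_lattice
  (fun a => gabor (window (Num.sqrt 2) halfcell) (z - a)).
Proof.
have s2 : Num.sqrt 2 * Num.sqrt 2 = 2 :> R by rewrite -expr2 sqr_sqrtr.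
split=> [a _|a a' [i [j ea]] [i' [j' ea']]].
  apply: inL2_gabor; [exact: measurable_halfcell|move=> x; exact].
have cell y x : halfcell (x - y) <-> (y <= x < y + 1 / 2).
  by rewrite /halfcell /= in_itv/=; lra.
have [eqa|nea] := eqVneq a a'.
  rewrite eqa inner_self//; congr Complex.
  by rewrite nrm2_halfcell sqr_sqrtr//; field.
apply: csqnorm_eq0.
have [ei|ni] := eqVneq i i'.
  have e : [set x | halfcell (x - (z - a).1) /\ halfcell (x - (z - a').1)] =
      `[(z - a).1, (z - a).1 + 1 / 2[%classic.
    by apply/seteqP; split => x /=; rewrite !cell ea ea' ei /= in_itv/=; lra.
  rewrite (@inner_gabor _ _ _ _ _ _ _ (z - a).1 ((z - a).1 + 1 / 2)).
  - rewrite e csqnormM csqnorm_int_exponential; last by lra.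
    have -> : (z - a).1 + 1 / 2 - (z - a).1 = 1 / 2 by ring.
    have -> : (z - a).2 - (z - a').2 = 2 * (j' - j)%:~R.
      by rewrite ea ea' /= intrB; ring.
    rewrite /kappa ifF; last first.
      apply/eqP => /eqP; rewrite mulf_eq0 pnatr_eq0 /= intr_eq0 subr_eq0 => /eqP ej.
      by move/eqP: nea; apply; rewrite ea ea' ei ej.
    have -> : pi * (2 * (j' - j)%:~R) * (1 / 2) = pi * (j' - j)%:~R :> R by field.
    by rewrite sin_pi_int mul0r expr0n mulr0.
  - by rewrite e; exact: measurable_itv.
  - by rewrite e.
have e : [set x | halfcell (x - (z - a).1) /\ halfcell (x - (z - a').1)] =
    `[0, 0[%classic.
  rewrite set_itvco0; apply/seteqP; split => x //=; rewrite !cell ea ea' /= => -[h h'].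
  have [|] : i + 1 <= i' \/ i' + 1 <= i by move/eqP: ni; lia.
    by rewrite -(ler_int R) intrD; lra.
  by rewrite -(ler_int R) intrD; lra.
rewrite (@inner_gabor _ _ _ _ _ _ _ 0 0).
- rewrite e csqnormM csqnorm_int_exponential// /kappa subrr mulr0 sin0.
  by rewrite mul0r expr0n; case: ifP => _; rewrite mulr0.
- by rewrite e; exact: measurable_itv.
- by rewrite e.
Qed.

(** The two-cell window is a unit vector and its squared coefficients on the normalized half cells
    are 2 [K (z - a)], so twice the sum is at most 1. *)
Lemma half_lattice_bessel (z : R * R) :
  (\esum_(a in half_lattice) (K (z - a)%R)%:E <= (1 / 2)%:E)%E.
Proof.
apply: esum_le_seq => S uS SA.
have Lf : inL2 setT (gabor (charfun (twocells N)) (0, 0) : R -> R[i]).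
  rewrite charfun_window; apply: inL2_gabor; [exact: measurable_twocells|exact: twocells_sub N2].
have := bessel measurableT (half_lattice_orthonormal z) Lf uS SA.
rewrite (nrm2_twocells N2).
under eq_bigr do rewrite (inner_halfcellr N2) sqr_sqrtr// subr0.
by rewrite -mulr_sumr; lra.
Qed.

Lemma mu2_box (p : R * R) (A B : set R) :
  measurable (A : set (measurableTypeR R)) ->
  measurable (B : set (measurableTypeR R)) ->
  (\int[@mu2 R]_z (\1_(A `*` B) (p - z)%R)%:E =
   mu ((fun x => (p.1 - x)%R) @^-1` A) * mu ((fun x => (p.2 - x)%R) @^-1` B))%E.
Proof.
move=> mA mB.
have ms (c : R) : measurable_fun setT ((fun x => c - x) : measurableTypeR R -> measurableTypeR R).
  exact: measurable_funB.
have mA' : measurable ((fun x => p.1 - x) @^-1` A : set (measurableTypeR R)).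
  by rewrite -[X in measurable X]setTI; exact: ms.
have mB' : measurable ((fun x => p.2 - x) @^-1` B : set (measurableTypeR R)).
  by rewrite -[X in measurable X]setTI; exact: ms.
rewrite -product_measure1E//.
have := integral_indic (@mu2 R) measurableT (measurableX mA' mB').
rewrite setIT => <-.
by apply: eq_integral => z _; rewrite !indicE; congr (_%:R%:E).
Qed.

Lemma mu_reflect_itv (c a b : R) : a <= b ->
  mu ((fun x => c - x) @^-1` `[a, b[) = (b - a)%:E.
Proof.
move=> ab.
have -> : (fun x => c - x) @^-1` `[a, b[ = `]c - b, c - a]%classic.
  by apply/seteqP; split => x /=; rewrite !in_itv/=; lra.
rewrite lebesgue_measure_itv/= lte_fin.
have [h|h] := ltP (c - b) (c - a); first by rewrite -EFinB; congr EFin; ring.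
by have -> : b - a = 0 by lra.
Qed.

Lemma measurable_indicX (A B : set R) :
  measurable (A : set (measurableTypeR R)) ->
  measurable (B : set (measurableTypeR R)) ->
  measurable_fun [set: plane] (\1_(A `*` B) : plane -> R).
Proof. by move=> mA mB; apply: measurable_indic; exact: measurableX. Qed.

(** The box g, half cell times [0, 2[, is a fundamental domain of [half_lattice], so the sum of its
    translates is at least 1. Exchanging sum and integral bounds the integral of [K] by the Bessel
    constant 1/2 times the area of the box, which is 1. *)
Lemma integral_overlap_kernel : (\int[@mu2 R]_z (K z)%:E <= (1 / 2)%:E)%E.
Proof.
pose g : R * R -> R := \1_(halfcell `*` `[0, 2[).
have mcell : measurable (`[0, 2[ : set (measurableTypeR R)) by exact: measurable_itv.
have mg : measurable_fun [set: plane] g.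
  by apply: measurable_indicX => //; exact: measurable_halfcell.
have mK := measurable_overlap_kernel.
have g0 z : 0 <= g z by rewrite /g indicE.
have := convolution_exchange 0 countable_half_lattice mK mg overlap_kernel_ge0 g0.
move=> exch.
apply: (@le_trans _ _ (\int[@mu2 R]_v ((K v)%:E *
    \esum_(a in half_lattice) (g (0 - a - v)%R)%:E))%E).
  apply: ge0_le_integral => //.
  - by move=> z _; rewrite lee_fin overlap_kernel_ge0.
  - exact/measurable_EFinP.
  - apply: emeasurable_funM; first exact/measurable_EFinP.
    apply: (@measurable_esum _ plane R _ half_lattice (fun (a : R * R) z => (g (0 - a - z))%:E)).
    + exact: countable_half_lattice.
    + by move=> a x; rewrite lee_fin.
    + by move=> a; apply/measurable_EFinP; exact: measurableT_comp mg (measurable_pair_subl _).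
  move=> v _; rewrite -[leLHS]mule1 lee_wpmul2l ?lee_fin ?overlap_kernel_ge0//.
  (* One term already gives the bound 1: the lattice point that moves -v into the box. *)
  have [a Aa [h1 h2]] := half_lattice_reduce (- v).
  apply: le_trans (@esum_ge_seq _ _ half_lattice (fun a => g (0 - a - v)) [:: a] _ _) => //.
    rewrite big_seq1 lee_fin /g indicE mem_set//.
    split => /=; rewrite /halfcell /= in_itv/=; move: h1 h2 => /=; lra.
  by move=> i; rewrite inE => /eqP ->.
rewrite exch.
apply: (@le_trans _ _ (\int[@mu2 R]_z ((1 / 2)%:E * (g (0 - z)%R)%:E))%E).
  apply: ge0_le_integral => //.
  - by move=> z _; rewrite mule_ge0 ?lee_fin// esum_ge0// => a _; rewrite lee_fin overlap_kernel_ge0.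
  - apply: emeasurable_funM.
      by apply/measurable_EFinP; exact: measurableT_comp mg (measurable_pair_subl _).
    apply: (@measurable_esum _ plane R _ half_lattice (fun (a : R * R) (z : plane) => (K (z - a))%:E)).
    + exact: countable_half_lattice.
    + by move=> a x; rewrite lee_fin overlap_kernel_ge0.
    + by move=> a; apply/measurable_EFinP; exact: measurableT_comp mK (measurable_pair_subr _).
  - apply: emeasurable_funM; first exact: measurable_cst.
    by apply/measurable_EFinP; exact: measurableT_comp mg (measurable_pair_subl _).
  by move=> z _; rewrite muleC lee_wpmul2r ?lee_fin// half_lattice_bessel.
rewrite ge0_integralZl//; last 2 first.
- by apply/measurable_EFinP; exact: measurableT_comp mg (measurable_pair_subl _).
- by move=> z _; rewrite lee_fin.
rewrite mu2_box//; last exact: measurable_halfcell.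
have h1 : 0 <= 1 / 2 :> R by lra.
rewrite !mu_reflect_itv//.
by rewrite -!EFinM lee_fin; lra.
Qed.

End Kernel.

(** * Completeness fills every window *)

Lemma sum_bool_count (R : realType) (T : Type) (b : pred T) (s : seq T) :
  \sum_(a <- s) (b a)%:R = (count b s)%:R :> R.
Proof. by elim: s => [|a s IH]; rewrite ?big_nil// big_cons IH -natrD. Qed.

Section Basis.
Context {R : realType} (N : nat) (A : set (R * R)).
Hypothesis N2 : (2 <= N)%N.
Hypothesis basis : gabor_orthonormal_basis (charfun (twocells N)) A.
Local Notation mu := (@lebesgue_measure R).
Local Notation plane := (measurableTypeR R * measurableTypeR R)%type.
Local Notation K := (@overlap_kernel R N).

Let NR : 2 <= N%:R :> R. Proof. by rewrite ler_nat. Qed.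

Let orth la la' : A la -> A la' -> la <> la' ->
  inner setT (gabor (charfun (twocells N)) la) (gabor (charfun (twocells N)) la') = 0.
Proof. by move=> Al Al' /eqP/negbTE ne; rewrite (basis.1.2 la la' Al Al') ne. Qed.

(** A frequency gap below 2 times an overlap length of at most 1/2 is below 1, which excludes the
    integer alternative of [orthogonal_near]. *)
Lemma basis_orth_near la la' : A la -> A la' -> la <> la' ->
  `|la.1 - la'.1| < 1 / 2 -> `|la.2 - la'.2| < 2 ->
  exists k : int, N%:R * (la.2 - la'.2) = 2 * k%:~R + 1.
Proof.
move=> Al Al' ne d e; have [x0 [[k hk]|//]] := orthogonal_near N2 d (orth Al Al' ne).
exfalso.
have h : 0 < 1 / 2 - `|la.1 - la'.1| <= 1 / 2.
  by have := normr_ge0 (la.1 - la'.1); lra.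
move: (1 / 2 - _) h hk => r h hk.
have : `|(la.2 - la'.2) * r| < 1.
  rewrite normrM [`|r|]ger0_norm; last by lra.
  by have := normr_ge0 (la.2 - la'.2); nra.
rewrite hk -intr_norm -[1]/(1%:~R) ltr_int => k1.
have k0 : k = 0 by lia.
move: hk; rewrite k0 => /eqP; rewrite mulf_eq0 (negbTE x0) /= => /eqP; lra.
Qed.

(** A nonzero integer is at least 1 in modulus while the overlap length is at most 1/2, so the
    frequency gap is at least 2. *)
Lemma basis_orth_far la la' : A la -> A la' ->
  `|la.1 - la'.1 - N%:R / 2| < 1 / 2 -> 2 <= `|la.2 - la'.2|.
Proof.
move=> Al Al' d.
have ne : la <> la'.
  by move=> e; move: d; rewrite e subrr sub0r normrN ger0_norm; have := NR; lra.
have [x0 [k hk]] := orthogonal_far N2 d (orth Al Al' ne).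
have h : 0 < 1 / 2 - `|la.1 - la'.1 - N%:R / 2| <= 1 / 2.
  by have := normr_ge0 (la.1 - la'.1 - N%:R / 2); lra.
move: (1 / 2 - _) h hk => r h hk.
have k0 : k <> 0.
  move=> k0; move: hk; rewrite k0 => /eqP; rewrite mulf_eq0 (negbTE x0) /= => /eqP; lra.
have : 1 <= `|(la.2 - la'.2) * r|.
  by rewrite hk -intr_norm -[1]/(1%:~R) ler_int; lia.
rewrite normrM [`|r|]ger0_norm; last by lra.
by have := normr_ge0 (la.2 - la'.2); nra.
Qed.

(** The parity alternative would make 2N odd. Otherwise 1 - 2|dt|, with dt the time difference, is a
    positive integer, which leaves dt = 0. *)
Lemma basis_orth_two la la' : A la -> A la' ->
  `|la.1 - la'.1| < 1 / 2 -> la.2 - la'.2 = 2 -> la.1 = la'.1.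
Proof.
move=> Al Al' d e.
have ne : la <> la' by move=> e'; move: e; rewrite e' subrr; lra.
have [_ [[k]|[k]]] := orthogonal_near N2 d (orth Al Al' ne); rewrite e => hk.
  have n0 := normr_ge0 (la.1 - la'.1).
  have k1 : (0%:~R : R) < k%:~R by lra.
  have k2 : k%:~R <= (1%:~R : R) by lra.
  have k3 : k = 1 by move: k1 k2; rewrite ltr_int ler_int; lia.
  have /eqP : `|la.1 - la'.1| = 0 by move: hk; rewrite k3; lra.
  by rewrite normr_eq0 subr_eq0 => /eqP.
exfalso; have : ((N%:Z * 2)%:~R : R) = (2 * k + 1)%:~R.
  by rewrite intrD !intrM -hk -pmulrn.
by move/intr_inj; lia.
Qed.

Let in_window (p a : R * R) := covers N p.1 a /\ 0 <= p.2 - a.2 < 2.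

Let window_no_three p a b c : A a -> A b -> A c -> a <> b -> b <> c -> a <> c ->
  in_window p a -> in_window p b -> in_window p c -> False.
Proof.
move=> Aa Ab Ac ab bc ac [c1 w1] [c2 w2] [c3 w3].
apply: (no_three N2 basis_orth_near basis_orth_far Aa Ab Ac ab bc ac c1 c2 c3);
  rewrite ltr_norml; clear ab bc ac; lra.
Qed.

Let window_seq p : exists s : seq (R * R), forall a, A a -> in_window p a -> a \in s.
Proof.
have [[a [Aa wa]]|na] := pselect (exists a, A a /\ in_window p a); last first.
  by exists [::] => a Aa wa; case: na; exists a.
have [[b [Ab wb ab]]|nb] := pselect (exists b, [/\ A b, in_window p b & a <> b]).
  exists [:: a; b] => c Ac wc; rewrite !inE.
  case: eqVneq => //= /eqP ca; case: eqVneq => //= /eqP cb.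
  by case: (window_no_three Aa Ab Ac ab (nesym cb) (nesym ca) wa wb wc).
exists [:: a] => b Ab wb; rewrite inE; apply: contrapT => /negP/eqP ba.
by case: nb; exists b; split => //; apply/nesym.
Qed.

Let right_stable (c l x : R) : exists2 e, 0 < e & forall d, 0 <= d < e ->
  c <= x + d < c + l -> c <= x < c + l.
Proof.
have [h|h] := ltP x c; last by exists 1 => // d; lra.
by exists (c - x); [lra|move=> d; lra].
Qed.

(** Windows are half-open, so a small move of p to the right and upwards lets no new element in. A
    uniform size of the move exists because only finitely many elements could enter. *)
Let window_right_stable (p : R * R) : exists2 e, 0 < e & forall v a, A a ->
  0 <= - v.1 < e -> 0 <= - v.2 < e -> in_window (p - v) a -> in_window p a.
Proof.
have one a : exists2 e, 0 < e & forall v,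
    0 <= - v.1 < e -> 0 <= - v.2 < e -> in_window (p - v) a -> in_window p a.
  have [e1 e10 H1] := right_stable (cell_start N false a) (1 / 2) p.1.
  have [e2 e20 H2] := right_stable (cell_start N true a) (1 / 2) p.1.
  have [e3 e30 H3] := right_stable a.2 2 p.2.
  exists (Num.min e1 (Num.min e2 e3)); first by rewrite !lt_min e10 e20.
  move=> v; rewrite !lt_min => /andP[v1 /and3P[h1 h2 h3]] /andP[v2 /and3P[k1 k2 k3]].
  rewrite /in_window /covers /in_cell => -[h w]; split; last first.
    by have := H3 (- v.2); move: w => /=; lra.
  by case: h => h; [left; apply: (H1 (- v.1))|right; apply: (H2 (- v.1))]; move: h => /=; lra.
have many (s : seq (R * R)) : exists2 e, 0 < e & forall v a, a \in s ->
    0 <= - v.1 < e -> 0 <= - v.2 < e -> in_window (p - v) a -> in_window p a.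
  elim: s => [|a s [e e0 He]]; first by exists 1.
  have [e' e'0 He'] := one a.
  exists (Num.min e e'); first by rewrite lt_min e0.
  move=> v b; rewrite !lt_min inE => /orP[/eqP ->|bs] /and3P[v1 h1 h2] /and3P[v2 k1 k2].
    by apply: He'; rewrite ?v1 ?v2 ?h2 ?k2.
  by apply: He => //; rewrite ?v1 ?v2 ?h1 ?k1.
(* For moves shorter than 1/4, every element of the moved window lies in one of four fixed windows:
   at p, and at p shifted by 1/4 in time, by 2 in frequency, or by both. *)
have [s1 H1] := window_seq p.
have [s2 H2] := window_seq (p.1, p.2 + 2).
have [s3 H3] := window_seq (p.1 + 1 / 4, p.2).
have [s4 H4] := window_seq (p.1 + 1 / 4, p.2 + 2).
have [e e0 He] := many (s1 ++ s2 ++ s3 ++ s4).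
exists (Num.min e (1 / 4)); first by rewrite lt_min e0; lra.
move=> v a Aa; rewrite !lt_min => /and3P[v1 h1 h2] /and3P[v2 k1 k2] w.
apply: (He v a) => //; rewrite ?v1 ?v2 ?h1 ?k1//.
rewrite !mem_cat.
have [c wf] := w.
have [cp|cp] : covers N p.1 a \/ covers N (p.1 + 1 / 4) a.
  by move: c; rewrite /covers /in_cell /= => -[] h;
    [have [?|?] := leP (cell_start N false a) p.1; [left; left|right; left]
    |have [?|?] := leP (cell_start N true a) p.1; [left; right|right; right]]; lra.
- have [f|f] := leP a.2 p.2.
    by rewrite H1//; split => //; move: wf => /=; lra.
  by rewrite H2 ?orbT//; split => //=; move: wf => /=; lra.
- have [f|f] := leP a.2 p.2.
    by rewrite H3 ?orbT//; split => //=; move: wf => /=; lra.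
  by rewrite H4 ?orbT//; split => //=; move: wf => /=; lra.
Qed.

Let g : R * R -> R := \1_(twocells N `*` `[0, 2[).

Let gE p a : g (p - a) = (`[< in_window p a >])%:R.
Proof.
rewrite /g indicE; congr (_%:R); congr nat_of_bool; apply/idP/asboolP; rewrite inE /=.
  by move=> [/twocells_covers h]; rewrite in_itv/= => w; split.
by move=> [h w]; split; [exact/twocells_covers|rewrite in_itv].
Qed.

Let window_sum_le2 p : (\esum_(a in A) (g (p - a))%:E <= 2%:E)%E.
Proof.
apply: esum_le_seq => S uS SA.
under eq_bigr do rewrite gE.
rewrite sum_bool_count -size_filter ler_nat.
have : uniq [seq a <- S | `[< in_window p a >]] by rewrite filter_uniq.
have : forall a, a \in [seq a <- S | `[< in_window p a >]] -> A a /\ in_window p a.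
  by move=> a; rewrite mem_filter => /andP[/asboolP w /SA].
move: [seq a <- S | _] => [|a [|b [|c s]]] //= H.
rewrite !inE !negb_or => /andP[/and3P[/eqP ab /eqP ac _] /andP[/andP[/eqP bc _] _]].
have [|Aa wa] := H a; rewrite ?inE ?eqxx//.
have [|Ab wb] := H b; rewrite ?inE ?eqxx ?orbT//.
have [|Ac wc] := H c; rewrite ?inE ?eqxx ?orbT//.
by case: (window_no_three Aa Ab Ac ab bc ac wa wb wc).
Qed.

Let window_sum_le1 p : ~ (exists a b, [/\ A a, A b, a <> b, in_window p a & in_window p b]) ->
  (\esum_(a in A) (g (p - a))%:E <= 1%:E)%E.
Proof.
move=> no2; apply: esum_le_seq => S uS SA.
under eq_bigr do rewrite gE.
rewrite sum_bool_count -size_filter (ler_nat _ _ 1).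
have : uniq [seq a <- S | `[< in_window p a >]] by rewrite filter_uniq.
have : forall a, a \in [seq a <- S | `[< in_window p a >]] -> A a /\ in_window p a.
  by move=> a; rewrite mem_filter => /andP[/asboolP w /SA].
move: [seq a <- S | _] => [|a [|b s]] //= H.
rewrite !inE !negb_or => /andP[/andP[/eqP ab _] _].
have [|Aa wa] := H a; rewrite ?inE ?eqxx//.
have [|Ab wb] := H b; rewrite ?inE ?eqxx ?orbT//.
by case: no2; exists a, b.
Qed.

(** The half cell has squared norm 1/2 and squared coefficients [K (z - a)]; finite sums come within
    any e of the norm. *)
Let parseval_lower z : ((1 / 2)%:E <= \esum_(a in A) (K (z - a))%:E)%E.
Proof.
have Lh : inL2 setT (gabor (window 1 halfcell) z : R -> R[i]).
  by apply: inL2_gabor; [exact: measurable_halfcell|move=> x; exact].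
apply/lee_addgt0Pr => e e0.
have [S [uS SA]] := parseval_le measurableT basis.1 basis.2 Lh e0.
rewrite nrm2_halfcell expr1n.
under eq_bigr do rewrite (inner_halfcell N2) expr1n mul1r.
move=> h; apply: le_trans (_ : _ <= (\sum_(i <- S) K (z - i) + e)%:E)%E _.
  by rewrite lee_fin ltW.
rewrite EFinD leeD2r//.
exact: (@esum_ge_seq _ _ A (fun a => K (z - a)) S uS SA).
Qed.

Let mu_reflect_twocells (c : R) : mu ((fun y => c - y) @^-1` (twocells N)) = 1%:E.
Proof.
rewrite /twocells preimage_setU.
have h1 : 0 <= 1 / 2 :> R by lra.
have h2 : N%:R / 2 <= N%:R / 2 + 1 / 2 :> R by lra.
have mI (a b : R) : measurable ((fun y => c - y) @^-1` `[a, b[ : set (measurableTypeR R)).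
  have -> : (fun y => c - y) @^-1` `[a, b[ = `]c - b, c - a]%classic.
    by apply/seteqP; split => y /=; rewrite !in_itv/=; lra.
  exact: measurable_itv.
rewrite measureU; [|exact: mI|exact: mI|].
  transitivity ((1 / 2 - 0 : R)%R%:E + (N%:R / 2 + 1 / 2 - N%:R / 2 : R)%R%:E)%E.
    by congr (_ + _)%E; exact: mu_reflect_itv.
  by rewrite -EFinD; congr EFin; lra.
by apply/seteqP; split => y //=; rewrite !in_itv/=; have := NR; lra.
Qed.

Hypothesis cA : countable A.

Theorem basis_two_per_window x w : exists la la',
  [/\ A la, A la', la <> la', covers N x la /\ covers N x la'
    & 0 <= w - la.2 < 2 /\ 0 <= w - la'.2 < 2].
Proof.
apply: contrapT => no2; pose p : R * R := (x, w).
have {}no2 : ~ (exists a b, [/\ A a, A b, a <> b, in_window p a & in_window p b]).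
  by move=> [a [b [Aa Ab ab [c1 w1] [c2 w2]]]]; apply: no2; exists a, b.
have [e0 e00 He0] := window_right_stable p.
(* The bound 1/4 keeps the square [Q] below inside the region where [K] is positive. *)
pose e := Num.min e0 (1 / 4).
have e_gt0 : 0 < e by rewrite lt_min e00; lra.
have [e_le e_le4] : e <= e0 /\ e <= 1 / 4 by rewrite /e !ge_min !lexx orbT.
move: (e) e_gt0 e_le e_le4 => {}e e_gt0 e_le e_le4.
(* For v in [Q] the point p - v lies to the right of and above p, the direction in which a window
   gains no element. *)
pose Q : set (R * R) := `]- e, 0] `*` `]- e, 0].
have no2Q v : Q v -> (\esum_(a in A) (g (p - v - a))%:E <= 1%:E)%E.
  move=> [] /=; rewrite !in_itv/= => v1 v2.
  apply: window_sum_le1 => -[a [b [Aa Ab ab wa wb]]]; apply: no2.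
  exists a, b; split => //; apply: (He0 v) => //; lra.
have mI (a b : itv_bound R) : measurable ([set` Interval a b] : set (measurableTypeR R)).
  exact: measurable_itv.
have mg : measurable_fun [set: plane] g.
  by apply: measurable_indicX => //; exact: measurable_twocells.
have mQ : measurable_fun [set: plane] (\1_Q : plane -> R) by exact: measurable_indicX.
have mK := @measurable_overlap_kernel R N.
have K0 := @overlap_kernel_ge0 R N.
have g0 z : 0 <= g z by rewrite /g indicE.
have mW : measurable_fun [set: plane] (fun v => \esum_(a in A) (g (p - a - v))%:E)%E.
  apply: (@measurable_esum _ plane R _ A (fun (a : R * R) z => (g (p - a - z))%:E)) => //.
  - by move=> a z; rewrite lee_fin.
  - by move=> a; apply/measurable_EFinP; exact: measurableT_comp mg (measurable_pair_subl _).
have W0 v : (0 <= \esum_(a in A) (g (p - a - v)%R)%:E)%E.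
  by apply: esum_ge0 => a _; rewrite lee_fin.
have exch := convolution_exchange p cA mK mg K0 g0.
(* Parseval bounds the inner sum by 1/2 from below, and the reflected box has area 1 times 2. *)
have lower : (1%:E <= \int[@mu2 R]_v ((K v)%:E * \esum_(a in A) (g (p - a - v)%R)%:E))%E.
  rewrite exch.
  apply: (@le_trans _ _ (\int[@mu2 R]_z ((1 / 2)%:E * (g (p - z)%R)%:E))%E).
    rewrite ge0_integralZl//; last 2 first.
    - by apply/measurable_EFinP; exact: measurableT_comp mg (measurable_pair_subl _).
    - by move=> z _; rewrite lee_fin.
    rewrite mu2_box//; last exact: measurable_twocells.
    have h1 : 0 <= 2 :> R by [].
    rewrite mu_reflect_twocells mu_reflect_itv// -!EFinM lee_fin; lra.
  apply: ge0_le_integral => //.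
  - by move=> z _; rewrite mule_ge0 ?lee_fin//; lra.
  - apply: emeasurable_funM; first exact: measurable_cst.
    by apply/measurable_EFinP; exact: measurableT_comp mg (measurable_pair_subl _).
  - apply: emeasurable_funM.
      by apply/measurable_EFinP; exact: measurableT_comp mg (measurable_pair_subl _).
    apply: (@measurable_esum _ plane R _ A (fun (a : R * R) (z : plane) => (K (z - a))%:E)) => //.
    + by move=> a z; rewrite lee_fin.
    + by move=> a; apply/measurable_EFinP; exact: measurableT_comp mK (measurable_pair_subr _).
  by move=> z _; rewrite muleC lee_wpmul2l ?lee_fin//; exact: parseval_lower.
have mQK : measurable_fun [set: plane] (fun v => (K v * \1_Q v)%:E).
  by apply/measurable_EFinP; exact: measurable_funM.
have QK0 v : (0 <= (K v * \1_Q v)%:E)%E by rewrite lee_fin mulr_ge0// indicE.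
(* The window count plus the indicator of [Q] is at most 2 everywhere, so the left side is at most
   twice the integral of [K]. Together with [lower] this leaves no mass of [K] on [Q]. *)
have upper : (\int[@mu2 R]_v ((K v)%:E * \esum_(a in A) (g (p - a - v)%R)%:E)
    + \int[@mu2 R]_v (K v * \1_Q v)%:E <= 1%:E)%E.
  rewrite -ge0_integralD//; last 2 first.
  - by move=> v _; rewrite mule_ge0// lee_fin.
  - by apply: emeasurable_funM => //; exact/measurable_EFinP.
  apply: (@le_trans _ _ (\int[@mu2 R]_v (2%:E * (K v)%:E))%E).
    apply: ge0_le_integral => //.
    - by move=> v _; rewrite adde_ge0// mule_ge0// lee_fin.
    - apply: emeasurable_funD => //.
      by apply: emeasurable_funM => //; exact/measurable_EFinP.
    - by apply: emeasurable_funM; [exact: measurable_cst|exact/measurable_EFinP].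
    move=> v _; rewrite EFinM -ge0_muleDr; [|exact: W0|by rewrite lee_fin indicE].
    rewrite muleC lee_wpmul2r ?lee_fin//.
    have sE : (\esum_(a in A) (g (p - a - v)%R)%:E = \esum_(a in A) (g (p - v - a)%R)%:E)%E.
      by apply: eq_esum => a _; rewrite addrAC.
    rewrite sE indicE; case: (pselect (Q v)) => Qv.
      rewrite mem_set// (_ : 2%:E = 1%:E + 1%:E)%E; last by rewrite -EFinD; congr EFin; lra.
      by rewrite leeD2r// no2Q.
    by rewrite memNset// adde0 window_sum_le2.
  rewrite ge0_integralZl//; last 2 first.
  - exact/measurable_EFinP.
  - by move=> v _; rewrite lee_fin.
  apply: (@le_trans _ _ (2%:E * (1 / 2)%:E)%E).
    by rewrite lee_wpmul2l ?lee_fin//; exact: integral_overlap_kernel.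
  by rewrite -EFinM lee_fin; lra.
have int0 : (\int[@mu2 R]_v (K v * \1_Q v)%:E = 0)%E.
  apply/eqP; rewrite eq_le integral_ge0// andbT.
  have : (1%:E + \int[@mu2 R]_v (K v * \1_Q v)%:E <= 1%:E + 0%:E)%E.
    by rewrite adde0; apply: le_trans upper; rewrite leeD2r.
  by rewrite leeD2lE.
have ae0 : ae_eq (@mu2 R) setT (fun v => (K v * \1_Q v)%:E) (cst 0%E).
  apply/(ae_eq_integral_abs _ measurableT mQK); rewrite -[RHS]int0.
  by apply: eq_integral => v _; rewrite gee0_abs.
have mu2Q : (@mu2 R Q = (e * e)%:E)%E.
  have mu1 : mu `]- e, 0]%classic = e%:E.
    by rewrite lebesgue_measure_itv/= lte_fin oppr_lt0 e_gt0 -EFinB sub0r opprK.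
  rewrite /mu2 product_measure1E//.
  by transitivity (e%:E * e%:E)%E => //; congr (_ * _)%E; exact: mu1.
have : (@mu2 R Q = 0)%E.
  case: ae0 => B [mBB B0 sB].
  apply: (@subset_measure0 _ _ _ (@mu2 R) Q B) => //; first exact: measurableX.
  move=> v Qv; apply: sB => /= /(_ I) [] /eqP.
  rewrite indicE mem_set// mulr1 => /eqP Kv0.
  have : 0 < K v.
    case: Qv => /=; rewrite !in_itv/= => v1 v2.
    by apply: overlap_kernel_gt0 => //; rewrite ltr_norml; lra.
  by rewrite Kv0 ltxx.
rewrite mu2Q => -[] /eqP; rewrite mulf_eq0 orbb => /eqP; move: e_gt0; lra.
Qed.

End Basis.

(** * Structure of the basis *)

Section Structure.
Context {R : realType} (N : nat) (Lam : set (R * R)).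
Local Notation Om := (@twocells R N).
Hypothesis N2 : (2 <= N)%N.
Hypothesis cLam : countable Lam.
Hypothesis basis : gabor_orthonormal_basis (charfun Om) Lam.
Local Notation mu := (@lebesgue_measure R).
Local Notation Re := complex.Re.
Local Notation Im := complex.Im.

Let NR : 2 <= N%:R :> R. Proof. by rewrite ler_nat. Qed.
Let near := basis_orth_near N2 basis.
Let far := basis_orth_far N2 basis.
Let two := basis_orth_two N2 basis.
Let window := basis_two_per_window N2 basis cLam.

Let fiber (t : R) : set R := [set nu | Lam (t, nu)].
Let times : set R := [set t | exists nu, Lam (t, nu)].

Let in_translate t x : translate t Om x <-> Om (x - t).
Proof.
split=> [[y Oy <-]|Oy]; first by rewrite addrC addKr.
by exists (x - t) => //; rewrite addrC subrK.
Qed.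

Let in_translate_covers t nu x : translate t Om x <-> covers N x (t, nu).
Proof. by rewrite in_translate; exact: (twocells_covers N x (t, nu)). Qed.

Let measurable_translate t :
  measurable (translate t Om : set (measurableTypeR R)).
Proof.
have -> : translate t Om = (fun x => x - t) @^-1` Om.
  by apply/seteqP; split => x /in_translate.
rewrite -[X in measurable X]setTI.
have ms : measurable_fun setT ((fun x => x - t) : measurableTypeR R -> measurableTypeR R).
  exact: measurable_funB.
by apply: ms => //; exact: measurable_twocells.
Qed.

Let translate_bounded t : translate t Om `<=` `[t, t + N%:R / 2 + 1 / 2[.
Proof.
move=> x /in_translate /(twocells_sub N2); rewrite /= !in_itv/=; lra.
Qed.

Lemma exponential_mul_conj (nu nu' x : R) :
  exponential nu x * conjc (exponential nu' x) = exponential (nu - nu') x.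
Proof.
by rewrite /exponential conjc_expi -expiD; congr expi; ring.
Qed.

Let inL2_exponential t nu : inL2 (translate t Om) (exponential nu).
Proof.
have [c1 c2] := continuous_exponential nu.
split.
- by apply: measurable_funTS; exact: continuous_measurable_fun.
- by apply: measurable_funTS; exact: continuous_measurable_fun.
- rewrite /sqnorm2.
  under eq_integral do rewrite csqnorm_expi.
  rewrite integral_cst; last exact: measurable_translate.
  rewrite mul1e; apply: (@le_lt_trans _ _ (mu `[t, t + N%:R / 2 + 1 / 2[%classic)).
    apply: le_measure; rewrite ?inE; first exact: measurable_translate.
      exact: measurable_itv.
    exact: translate_bounded.
  rewrite lebesgue_measure_itv/=.
  by case: ifP => _; rewrite -?EFinB ltry.
Qed.

Let fiber_orthonormal t : times t ->
  orthonormal_family (translate t Om) (fiber t) exponential.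
Proof.
move=> _; split=> [nu _|nu nu' Fnu Fnu']; first exact: inL2_exponential.
have := basis.1.2 (t, nu) (t, nu') Fnu Fnu'.
have e : [set x | Om (x - t) /\ Om (x - t)] = translate t Om.
  by apply/seteqP; split => x /=; rewrite in_translate; [case|split].
rewrite charfun_window (@inner_gabor _ _ _ _ _ _ _ t (t + N%:R / 2 + 1 / 2)).
- rewrite e /= mulr1 xpair_eqE eqxx /= => <-.
  rewrite -[LHS]mul1r; congr (_ * _).
  by congr cintegral; apply/funext => x; exact: exponential_mul_conj.
- by rewrite /= e; exact: measurable_translate.
- by rewrite /= e; exact: translate_bounded.
Qed.

Let gabor_fiber t nu x : translate t Om x ->
  gabor (charfun Om) (t, nu) x = exponential nu x.
Proof.
move=> /in_translate Ox; rewrite /gabor /charfun /= indicE mem_set//.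
by rewrite -[RHS]mul1r; congr (_ * expi _); ring.
Qed.

(** The point x is covered by (t, nu0), and all elements covering a point have the same time. *)
Let gabor_off_fiber t nu0 la x : Lam (t, nu0) -> Lam la -> la.1 != t ->
  translate t Om x -> gabor (charfun Om) la x = 0.
Proof.
move=> L0 Lla ne /(in_translate_covers _ nu0) c.
rewrite /gabor /charfun indicE memNset ?mul0r//.
move=> /twocells_covers c'.
have /= e := covers_time N2 near far two window Lla L0 c' c.
by rewrite e eqxx in ne.
Qed.

(** Extend f by zero, approximate it by Gabor elements on the line and restrict to the translate:
    elements with another time vanish there, and those with time t are exponentials. *)
Let fiber_total t : times t ->
  total_family (translate t Om) (fiber t) exponential.
Proof.
move=> [nu0 L0] f [mr mi fin] eps eps0.
set D := translate t Om.
have mD : measurable (D : set (measurableTypeR R)) by exact: measurable_translate.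
pose F x := if x \in D then f x else 0.
have ReF : (fun x => Re (F x)) = (fun x => Re (f x)) \_ D.
  by apply/funext => x; rewrite /F patchE; case: (x \in D).
have ImF : (fun x => Im (F x)) = (fun x => Im (f x)) \_ D.
  by apply/funext => x; rewrite /F patchE; case: (x \in D).
have LF : inL2 setT F.
  split.
  - by rewrite ReF; apply/(measurable_restrictT _ _).1.
  - by rewrite ImF; apply/(measurable_restrictT _ _).1.
  - move: fin; rewrite /sqnorm2 integral_mkcond; congr (_ < _)%E.
    apply: eq_integral => x _; rewrite patchE /F; case: (x \in D) => //.
    by rewrite csqnorm0.
have [s [c [sL h]]] := basis.2 F LF eps eps0.
exists [seq la.2 | la <- s & la.1 == t], (fun nu => c (t, nu)); split.
  move=> nu /mapP[la]; rewrite mem_filter => /andP[/eqP e /sL Lla] ->.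
  by rewrite /fiber /= -e -surjective_pairing.
apply: le_lt_trans h; rewrite /sqnorm2.
have [cr ci _] := inL2_comb measurableT basis.1 c sL LF.
apply: (@le_trans _ _ (\int[mu]_(x in D) (csqnorm (F x - \sum_(i <- s) c i *
    gabor (charfun Om) i x))%:E)%E).
  rewrite le_eqVlt; apply/orP; left; apply/eqP; apply: eq_integral => x.
  rewrite inE => Dx; congr (csqnorm (_ - _))%:E; first by rewrite /F mem_set.
  rewrite big_map big_filter big_mkcond /=; apply: eq_big_seq => la ls.
  case: eqVneq => [e|ne].
    by rewrite -(gabor_fiber la.2 Dx) -e -surjective_pairing.
  by rewrite (gabor_off_fiber L0 (sL _ ls) ne Dx) mulr0.
apply: ge0_subset_integral => //.
- apply/measurable_EFinP; apply: measurable_funD; exact: measurable_funX.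
- by move=> x _; rewrite lee_fin csqnorm_ge0.
Qed.

Lemma basis_standard : standard Om Lam.
Proof.
exists times, fiber; split.
- apply/seteqP; split => [[t nu] Lla|[t nu] [t' _ [/= -> //]]].
  by exists t; [exists nu|].
- apply/seteqP; split => // x _.
  have [la [_ [Lla _ _ [c _] _]]] := window x 0.
  exists la.1; first by exists la.2; rewrite -surjective_pairing.
  by apply/(in_translate_covers _ la.2); rewrite -surjective_pairing.
- by move=> t Jt; split; [exact: fiber_orthonormal|exact: fiber_total].
Qed.

Lemma basis_standard_form : exists tau : R, 0 <= tau < 1 / 2 /\
  exists (K : set R) (L : R -> set R) (a : R -> R),
    Lam = \bigcup_(k in K)
      ([set tau + k / 2] `*` divset (translate (a k) (L k)) N%:R) /\
    (K `<=` intset /\ forall k, K k -> L k `<=` intset) /\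
    (forall k, K k -> 0 <= a k < 1) /\
    K `|` translate N%:R K = intset /\
    (forall k, K k ->
       sumset (L k)
         [set 2 * n%:~R | n in [set n : int | `|n%:~R| <= N%:R - 1 :> R]]
       = intset).
Proof.
have [tau [tau01 startsE]] := starts_lattice N2 near far two window.
exists tau; split => //.
have N0 : N%:R != 0 :> R by rewrite gt_eqF//; have := NR; lra.
pose K : set R := [set r | exists k : int, r = k%:~R /\ exists nu, Lam (tau + r / 2, nu)].
pose nu0 r := xget 0 [set nu | Lam (tau + r / 2, nu)].
have nu0P r : K r -> Lam (tau + r / 2, nu0 r).
  move=> [k [_ [nu Lnu]]].
  exact: (@xgetPex _ 0 [set nu | Lam (tau + r / 2, nu)]) (ex_intro _ nu Lnu).
(* By [fiber_diff] the numbers N nu over one time agree modulo 1, so the fractional part at the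
   chosen [nu0 r] serves the whole fiber. *)
pose a r : R := N%:R * nu0 r - (Num.floor (N%:R * nu0 r))%:~R.
pose L r : set R := [set l | exists m : int, l = m%:~R /\ Lam (tau + r / 2, (a r + l) / N%:R)].
have inL r nu : K r -> Lam (tau + r / 2, nu) -> exists m : int,
    N%:R * nu = a r + m%:~R /\ L r m%:~R.
  move=> Kr Lnu; have [m hm] := fiber_diff N2 near far two window Lnu (nu0P r Kr).
  have e : N%:R * nu = a r + (m + Num.floor (N%:R * nu0 r))%:~R.
    by rewrite intrD /a -hm; ring.
  exists (m + Num.floor (N%:R * nu0 r)); split => //.
  by eexists; split; [reflexivity|]; rewrite -e [N%:R * _]mulrC mulfK.
exists K, L, a; split; [|split; [split|split; [|split]]].
- apply/seteqP; split => [[t nu] Lla|[t nu] [k Kk [/= ->]]].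
    have [/= k hk] : exists k : int, t = tau + k%:~R / 2.
      by apply/startsE; exists (t, nu), false; rewrite /cell_start addr0.
    have Kk : K k%:~R by exists k; split => //; exists nu; rewrite -hk.
    have Lnu : Lam (tau + k%:~R / 2, nu) by rewrite -hk.
    have [m [hm Lm]] := inL _ _ Kk Lnu.
    exists k%:~R => //; split => //=; exists (a k%:~R + m%:~R); first by exists m%:~R.
    by rewrite -hm [N%:R * _]mulrC mulfK.
  by move=> [_ [l [m [_ Ll]] <-] <-].
- by move=> _ [k [-> _]]; exists k.
- by move=> k _ _ [m [-> _]]; exists m.
- move=> k _; rewrite /a; have := floor_itv (N%:R * nu0 k); rewrite intrD; lra.
- apply/seteqP; split => [_ [[k [-> _]]|[_ [k [-> _]] <-]]|_ [k _ <-]].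
  + by exists k.
  + by exists (N%:Z + k) => //; rewrite intrD -pmulrn.
  (* A half cell starts at tau + k/2. If it is a first half, k is in [K]; if it is a second half, k
     - N is. *)
  + have [la [b [Lla e]]] : exists la b, Lam la /\ tau + k%:~R / 2 = cell_start N b la.
      by apply/startsE; exists k.
    case: b e; rewrite /cell_start => e.
      right; exists (k - N%:Z)%:~R; last by rewrite intrB -pmulrn; ring.
      exists (k - N%:Z); split => //; exists la.2.
      have -> : tau + (k - N%:Z)%:~R / 2 = la.1 by rewrite intrB -pmulrn; lra.
      by rewrite -surjective_pairing.
    left; exists k; split => //; exists la.2.
    have -> : tau + k%:~R / 2 = la.1 by lra.
    by rewrite -surjective_pairing.
- move=> k Kk; apply/seteqP; split.
    move=> _ [l [m [-> _]]] [_ [n _ <-] <-].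
    by exists (m + 2 * n) => //; rewrite intrD intrM.
  move=> _ [m _ <-].
  (* This window corresponds to the integers l of [L k] with m - N < l <= m + N. The two found have
     opposite parities, so one of them, j, has the parity of m. *)
  have [f [f' [Lf Lf' wf wf' [q hq]]]] :=
    fiber_window N2 near far two window ((m%:~R + N%:R + a k) / N%:R) (nu0P k Kk).
  have [l [hl Ll]] := inL _ _ Kk Lf; have [l' [hl' Ll']] := inL _ _ Kk Lf'.
  have bound (x : R) (j : int) : 0 <= (m%:~R + N%:R + a k) / N%:R - x < 2 ->
      N%:R * x = a k + j%:~R -> m - N%:Z <= j <= m + N%:Z.
    move=> + e; have -> : x = (a k + j%:~R) / N%:R by rewrite -e [N%:R * _]mulrC mulfK.
    rewrite -mulrBl ler_pdivlMr ?ltr_pdivrMr; [|have := NR; lra..].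
    rewrite mul0r => h.
    by rewrite -!(ler_int R) intrB intrD -pmulrn; lra.
  have bl := bound _ _ wf hl; have bl' := bound _ _ wf' hl'.
  have odd_diff : l - l' = 2 * q + 1.
    by apply: (@intr_inj R); rewrite intrB intrD intrM -hq mulrBr hl hl'; ring.
  have [j [Lj bj [n jn]]] : exists j : int, [/\ L k j%:~R, m - N%:Z <= j <= m + N%:Z &
      exists n : int, m = j + 2 * n].
    have [[n hn]|[n hn]] : (exists n, m - l = 2 * n) \/ (exists n, m - l = 2 * n + 1).
    - by have [?|?] := boolP ((m - l) %% 2 == 0)%Z;
        [left; exists ((m - l) %/ 2)%Z|right; exists ((m - l) %/ 2)%Z]; lia.
    - by exists l; split => //; exists n; lia.
    - by exists l'; split => //; exists (n + q + 1); lia.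
  exists j%:~R => //; exists (2 * n%:~R); last by rewrite jn intrD intrM.
  exists n => //=.
  (* From |2n| <= N follows |n| <= N - 1, because N >= 2. *)
  rewrite -intr_norm; have -> : N%:R - 1 = (N%:Z - 1)%:~R :> R by rewrite intrB -pmulrn.
  by rewrite ler_int; lia.
Qed.

End Structure.

(** * The result in the parameters alpha and beta *)

Unset Implicit Arguments.
Set Strict Implicit.
Set Printing Implicit Defensive.

Theorem theorem4p8 (R : realType) (alpha beta : R) (Lambda : set (R * R))
    (halpha : alpha = 1 / 2)
    (hbeta : exists n : nat, (0 < n)%N /\ beta = n%:R / 2)
    (hdiscrete : discrete_set Lambda)
    (hcountable : countable Lambda)
    (hbasis : gabor_orthonormal_basis (charfun (OmegaS alpha beta)) Lambda) :
  standard (OmegaS alpha beta) Lambda /\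
  exists tau : R, 0 <= tau < 1 / 2 /\
  exists (K : set R) (L : R -> set R) (a : R -> R),
    standard_form beta tau Lambda K L a /\
    (K `<=` intset /\ forall k, K k -> L k `<=` intset) /\
    (forall k, K k -> 0 <= a k < 1) /\
    K `|` translate (2 * beta + 1) K = intset /\
    (forall k, K k ->
       sumset (L k)
         [set 2 * n%:~R | n in [set n : int | `|n%:~R| <= 2 * beta]]
       = intset).
Proof.
have [n [n0 hb]] := hbeta.
(* With beta = n/2 the integer N = 2 beta + 1 is [n.+1], at least 2 because n is positive. *)
have N2 : (2 <= n.+1)%N by [].
have NE : 2 * beta + 1 = n.+1%:R by rewrite hb -[n.+1%:R]natr1; field.
have bE : 2 * beta = n.+1%:R - 1 by rewrite -NE addrK.
have OE : OmegaS alpha beta = twocells n.+1.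
  rewrite /OmegaS /twocells halpha -NE; congr (_ `|` _).
  by apply/seteqP; split => x /=; rewrite !in_itv/=; lra.
rewrite OE in hbasis *.
split; first exact: basis_standard.
rewrite /standard_form NE bE.
exact: basis_standard_form.
Qed.
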